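(* Let $n=n_1+\dots+n_k=p+q$ with $k\ge 2$ and all $n_i,p,q$ positive integers, let $G=U(n)$, and let $L=U(n_1)\times\cdots\times U(n_k)$ and $H=U(p)\times U(q)$ be the natural block-diagonal subgroups of $G$. In each of the following cases there exists a subset $B\subset O(n)$ with $G=LBH$ (i.e. every $g\in G$ can be written $g=xbh$ with $x\in L$, $b\in B$, $h\in H$), where $B$ has the indicated form: Case 0 ($k=2$): $B\simeq\mathbb{T}^{\min(n_1,n_2,p,q)}$; Case I ($k=3$ and $n_1=1$): $B\simeq\mathbb{T}^{\min(p,q,n_2,n_3)}\cdot\mathbb{T}^{\min(p,q,n_2+1,n_3+1)}$; Case II ($k=3$, $\min(n_1,n_2,n_3)\ge 2$ and $\min(p,q)=2$): $B\simeq\mathbb{T}^2\cdot\mathbb{T}\cdot\mathbb{T}^2$; Case III ($\min(p,q)=1$, arbitrary $k$): $B\simeq\mathbb{T}\cdot\cdots\cdot\mathbb{T}$ with $k-1$ factors.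
   Context: $\mathbb{T}$ denotes the circle group and $\mathbb{T}^a$ an $a$-dimensional torus. A toral subgroup means a compact connected abelian (torus) subgroup. The notation $\mathbb{T}^{a_1}\cdot\mathbb{T}^{a_2}\cdots\mathbb{T}^{a_r}$ means a subset of $G$ of the form $\{x_1x_2\cdots x_r: x_j\in T_j\}$ for some toral subgroups $T_j$ with $T_j\simeq\mathbb{T}^{a_j}$; in the theorem these toral subgroups lie in $O(n)$. In Case I the indices are labeled so that $n_1=1$. *)

(* Defs.v *)
From HB Require Import structures.
From mathcomp Require Import all_boot all_order all_algebra.
From mathcomp Require Import all_classical all_reals all_analysis.
From mathcomp Require Import complex.

Set Implicit Arguments.
Unset Strict Implicit.
Unset Printing Implicit Defensive.

Import Order.TTheory GRing.Theory Num.Theory.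
Import numFieldNormedType.Exports.
Local Open Scope ring_scope.
Local Open Scope classical_set_scope.

(* Complex numbers over the reals R : realType are R[i] (mathcomp-real-closed). *)

(* The unitary group U(n): complex matrices with U U^* = 1. *)
Definition unitary (R : realType) (n : nat) (U : 'M[R[i]]_n) : Prop :=
  U *m (map_mx (fun z : R[i] => z^*) U)^T = 1%:M.

(* The orthogonal group O(n): real matrices with A A^T = 1. *)
Definition orthogonal (R : realType) (n : nat) (A : 'M[R]_n) : Prop :=
  A *m A^T = 1%:M.

(* Embedding of real matrices into complex matrices (O(n) inside U(n)). *)
Definition cplx_mx (R : realType) (n : nat) (A : 'M[R]_n) : 'M[R[i]]_n :=
  map_mx (fun r : R => (r%:C)%C) A.

(* Partial sums n_1, n_1+n_2, ..., n_1+...+n_k of the composition ns. *)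
Definition psums (ns : seq nat) : seq nat :=
  [seq \sum_(l < m.+1) nth 0%N ns l | m <- iota 0 (size ns)].

(* Index (0-based) of the diagonal block containing coordinate i
   for the block decomposition given by ns. *)
Definition blk (ns : seq nat) (i : nat) : nat :=
  find (fun s => (i < s)%N) (psums ns).

(* A matrix is block diagonal w.r.t. the block sizes ns. *)
Definition blockdiag (R : realType) (n : nat) (ns : seq nat) (A : 'M[R[i]]_n)
  : Prop := forall i j : 'I_n, blk ns i <> blk ns j -> A i j = 0.

(* L = U(n_1) x ... x U(n_k) embedded block-diagonally in U(n). *)
Definition Lsub (R : realType) (n : nat) (ns : seq nat) : set 'M[R[i]]_n :=
  [set A | unitary A /\ blockdiag ns A].

(* Toral subgroup of O(n) of dimension a: the image T of a continuous group
   homomorphism phi : R^a -> O(n) whose kernel is exactly Z^a; then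
   T is isomorphic (as a topological group) to R^a/Z^a = T^a. *)
Definition toral (R : realType) (n a : nat) (T : set 'M[R]_n) : Prop :=
  exists phi : 'rV[R]_a -> 'M[R]_n,
    [/\ continuous phi,
        (forall x y, phi (x + y) = phi x *m phi y),
        (forall x, orthogonal (phi x)),
        (forall x, phi x = 1%:M <-> (forall j, x 0 j \is a Num.int)) &
        T = range phi].

(* Pointwise product set T_1 . T_2 ... T_r = { x_1 x_2 ... x_r : x_j in T_j }. *)
Fixpoint prodset (R : realType) (n : nat) (Ts : seq (set 'M[R]_n))
  : set 'M[R]_n :=
  match Ts with
  | [::] => [set 1%:M]
  | T :: Ts' => [set m | exists x y, [/\ T x, prodset Ts' y & m = x *m y]]
  end.

(* B has the form T^{a_1} . T^{a_2} ... T^{a_r} with toral subgroups of O(n). *)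
Definition torus_product (R : realType) (n : nat) (dims : seq nat)
  (B : set 'M[R]_n) : Prop :=
  exists Ts : seq (set 'M[R]_n),
    [/\ size Ts = size dims,
        (forall j, (j < size Ts)%N -> toral (nth 0%N dims j) (nth set0 Ts j)) &
        B = prodset Ts].

(* G = L B H: every g in U(n) is x b h with x in L, b in B, h in H. *)
Definition LBH_decomp (R : realType) (n : nat) (ns : seq nat) (p q : nat)
  (B : set 'M[R]_n) : Prop :=
  forall g : 'M[R[i]]_n, unitary g ->
    exists x b h, [/\ Lsub ns x, B b, Lsub [:: p; q] h &
                      g = x *m cplx_mx b *m h].

(* Existence of B of the given form. *)
Definition has_decomp (R : realType) (n : nat) (ns : seq nat) (p q : nat)
  (dims : seq nat) : Prop :=
  exists B : set 'M[R]_n, torus_product dims B /\ LBH_decomp ns p q B.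

(* Main.v *)
Require Import Defs.
From HB Require Import structures.
From mathcomp Require Import all_boot all_order all_algebra.
From mathcomp Require Import all_classical all_reals all_analysis.
From mathcomp Require Import complex ring lra zify.

(* Left and right multiplication by L and H is used to clear one row (for H) or
   one column (for L) of a unitary matrix up to a real vector supported on two
   coordinates, which a real plane rotation then turns into a basis vector. The
   planes are chosen so that the block factors of the later steps fix their
   coordinates, hence commute past the rotations, which collect into tori.
   - Two blocks: generalized CS decomposition; a left eigenvector of g11 g11^H
     (g11 the corner block) makes the remaining rows orthogonal to both halves
     of the row being cleared.
   - Blocks 1, n2, n3: rows and columns are cleared alternately, rows in the
     planes (k, n-1-k) and columns in the planes (k+1, n-1-k).
   - min(p, q) = 2: g = x t h for the coarser group U(n1) x U(n2+n3), then
     x = y t' k, and the U(2) part of k is diagonal * rotation * diagonal; the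
     phases are absorbed by transferring them through t' and t.
   - min(p, q) = 1: clear the single distinguished column block by block. *)

Set Implicit Arguments.
Unset Strict Implicit.
Unset Printing Implicit Defensive.
Import Order.TTheory GRing.Theory Num.Theory.
Import numFieldNormedType.Exports.
Local Open Scope ring_scope.
Local Open Scope classical_set_scope.

(** The tori have to be fixed before [g] is known; only the angles may depend on [g]. So the
    coordinate planes are settled in advance, and the difficulty is to carry the block factors that
    arise between two rotations out to the left into [L] or to the right into [H]. For this reason
    every factor is recorded with a support, a set of coordinates outside which it is the identity:
    factors with disjoint supports commute. Real rotations suffice because a unitary of one block
    can turn the part of a vector in that block into a nonnegative real multiple of a basis vector,
    which leaves no phase for the rotation to handle. When [minn p q = 2], a factor U(2) is trapped
    between the two tori, on coordinates that both of them move, so disjointness of supports is of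
    no help. Modulo diagonal matrices on both sides it is one rotation, whence the middle circle. A
    diagonal matrix does pass a torus of plane rotations once its phases agree on the two
    coordinates of each plane, and correcting them on the partner coordinates costs a factor that is
    disjoint from everything it still has to cross. *)

Section UnitaryMatrices.
Variable R : realType.
Local Notation C := R[i].

Definition adjm m n (A : 'M[C]_(m, n)) : 'M[C]_(n, m) :=
  (map_mx (fun z : C => z^*) A)^T.

Lemma adjmE m n (A : 'M[C]_(m, n)) i j : adjm A i j = (A j i)^*.
Proof. by rewrite !mxE. Qed.

Lemma adjmK m n (A : 'M[C]_(m, n)) : adjm (adjm A) = A.
Proof. by apply/matrixP=> i j; rewrite !adjmE conjCK. Qed.

Lemma adjmM m n p (A : 'M[C]_(m, n)) (B : 'M[C]_(n, p)) :
  adjm (A *m B) = adjm B *m adjm A.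
Proof.
apply/matrixP=> i j; rewrite adjmE !mxE rmorph_sum; apply: eq_bigr => k _.
by rewrite !adjmE rmorphM mulrC.
Qed.

Lemma adjm1 n : adjm (1%:M : 'M[C]_n) = 1%:M.
Proof. by apply/matrixP=> i j; rewrite adjmE !mxE rmorph_nat eq_sym. Qed.

Lemma adjmD m n (A B : 'M[C]_(m, n)) : adjm (A + B) = adjm A + adjm B.
Proof. by apply/matrixP=> i j; rewrite !(adjmE, mxE) rmorphD. Qed.

Lemma adjmN m n (A : 'M[C]_(m, n)) : adjm (- A) = - adjm A.
Proof. by apply/matrixP=> i j; rewrite !(adjmE, mxE) rmorphN. Qed.

Lemma adjmZ m n c (A : 'M[C]_(m, n)) : adjm (c *: A) = c^* *: adjm A.
Proof. by apply/matrixP=> i j; rewrite !(adjmE, mxE) rmorphM. Qed.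

Lemma adjm_delta n i : adjm (delta_mx 0 i : 'rV[C]_n) = delta_mx i 0.
Proof. by apply/matrixP=> k l; rewrite adjmE !mxE rmorph_nat andbC. Qed.

Lemma unitary_adjr n (U : 'M[C]_n) : unitary U -> U *m adjm U = 1%:M.
Proof. by []. Qed.

Lemma unitary_adjl n (U : 'M[C]_n) : unitary U -> adjm U *m U = 1%:M.
Proof. by move=> h; apply: mulmx1C. Qed.

Lemma unitaryM n (U V : 'M[C]_n) : unitary U -> unitary V -> unitary (U *m V).
Proof.
move=> hU hV; rewrite /unitary -/(adjm _) adjmM mulmxA -(mulmxA U).
by rewrite unitary_adjr // mulmx1.
Qed.

Lemma unitary_adj n (U : 'M[C]_n) : unitary U -> unitary (adjm U).
Proof. by move=> hU; rewrite /unitary -/(adjm _) adjmK unitary_adjl. Qed.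

Lemma unitary1 n : unitary (1%:M : 'M[C]_n).
Proof. by rewrite /unitary -/(adjm _) adjm1 mulmx1. Qed.

Definition dotu n (u v : 'rV[C]_n) : C := (u *m adjm v) 0 0.

Lemma dotuE n (u v : 'rV[C]_n) : dotu u v = \sum_i u 0 i * (v 0 i)^*.
Proof. by rewrite /dotu mxE; apply: eq_bigr => i _; rewrite adjmE. Qed.

Lemma dotu_mx n (u v : 'rV[C]_n) : u *m adjm v = (dotu u v)%:M.
Proof. by rewrite [LHS]mx11_scalar. Qed.

Lemma dotuM n (u v : 'rV[C]_n) (M : 'M[C]_n) :
  unitary M -> dotu (u *m M) (v *m M) = dotu u v.
Proof. by move=> hM; rewrite /dotu adjmM mulmxA -(mulmxA u) hM mulmx1. Qed.

Lemma dotuZl n c (u v : 'rV[C]_n) : dotu (c *: u) v = c * dotu u v.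
Proof. by rewrite /dotu -scalemxAl mxE. Qed.

Lemma dotuZr n c (u v : 'rV[C]_n) : dotu u (c *: v) = c^* * dotu u v.
Proof. by rewrite /dotu adjmZ -scalemxAr mxE. Qed.

Lemma dotuBl n (u v w : 'rV[C]_n) : dotu (u - v) w = dotu u w - dotu v w.
Proof. by rewrite /dotu mulmxBl !mxE. Qed.

Lemma dotuBr n (u v w : 'rV[C]_n) : dotu w (u - v) = dotu w u - dotu w v.
Proof. by rewrite /dotu adjmD adjmN mulmxBr !mxE. Qed.

Lemma dotuC n (u v : 'rV[C]_n) : (dotu u v)^* = dotu v u.
Proof.
by rewrite !dotuE rmorph_sum; apply: eq_bigr => i _; rewrite rmorphM /= conjCK mulrC.
Qed.

Lemma dotu_deltar n (u : 'rV[C]_n) i : dotu u (delta_mx 0 i) = u 0 i.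
Proof. by rewrite /dotu adjm_delta -colE mxE. Qed.

Lemma dotu_ge0 n (u : 'rV[C]_n) : 0 <= dotu u u.
Proof. by rewrite dotuE sumr_ge0 // => i _; apply: mul_conjC_ge0. Qed.

Lemma dotu_eq0 n (u : 'rV[C]_n) : (dotu u u == 0) = (u == 0).
Proof.
apply/idP/eqP => [|->]; last by rewrite /dotu mul0mx mxE.
rewrite dotuE psumr_eq0 => [/allP h|i _]; last exact: mul_conjC_ge0.
apply/rowP=> i; rewrite mxE; apply/eqP; rewrite -mul_conjC_eq0.
exact: h (mem_index_enum i).
Qed.

Lemma ge0_real_sqr (x : C) : 0 <= x -> exists2 c : R, 0 <= c & x = (c ^+ 2)%:C%C.
Proof.
case: x => a b; rewrite lecE /= => /andP[/eqP -> a0].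
by exists (Num.sqrt a); rewrite ?sqrtr_ge0 // sqr_sqrtr.
Qed.

(* The map [1 - (z^H z) / (w z^H)] with [z = w - y], [z^H] the conjugate
   transpose: unlike a genuine Householder reflection it needs no phase
   condition on the inner product of [w] and [y]. *)
Lemma householder n (w y : 'rV[C]_n) : dotu w w = dotu y y ->
  exists M : 'M[C]_n, [/\ unitary M, w *m M = y &
    forall i j, (w 0 i == y 0 i) || (w 0 j == y 0 j) -> M i j = (i == j)%:R].
Proof.
move=> wy; have [->|neq] := eqVneq w y.
  by exists 1%:M; rewrite mulmx1; split=> // [|i j _]; [apply: unitary1|rewrite mxE].
set z := w - y; set c := dotu w z.
have zz : dotu z z = c + c^*.
  by rewrite /c dotuC /z !(dotuBl, dotuBr) wy; ring.
have z0 : dotu z z != 0 by rewrite dotu_eq0 subr_eq0.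
have c0 : c != 0 by apply: contraNneq z0 => c0; rewrite zz c0 conjC0 addr0.
have c0' : c^* != 0 by rewrite conjC_eq0.
pose Z := adjm z *m z.
have ZZ : Z *m Z = dotu z z *: Z.
  rewrite /Z mulmxA -(mulmxA (adjm z)) dotu_mx mul_mx_scalar.
  by rewrite -scalemxAl.
exists (1%:M - c^-1 *: Z); split.
- rewrite /unitary -/(adjm _) adjmD adjmN adjm1 adjmZ adjmM adjmK -/Z fmorphV /=.
  rewrite mulmxBl mul1mx mulmxBr mulmx1 -scalemxAl -scalemxAr ZZ !scalerA.
  rewrite -scalerBl -addrA -opprD -scalerDl zz.
  have -> : c^*^-1 + (c^-1 - c^-1 / c^* * (c + c^*)) = 0.
    by field; rewrite c0 c0'.
  by rewrite scale0r subr0.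
- rewrite mulmxBr mulmx1 -scalemxAr mulmxA dotu_mx -/c mul_scalar_mx scalerA.
  by rewrite mulVf // scale1r /z subKr.
- move=> i j h; rewrite !mxE big_ord1 adjmE !mxE.
  suff -> : (w 0 i - y 0 i)^* * (w 0 j - y 0 j) = 0 by rewrite mulr0 subr0.
  by case/orP: h => /eqP ->; rewrite subrr ?conjC0 ?mul0r ?mulr0.
Qed.

End UnitaryMatrices.

(** * Unitaries with prescribed support and block structure *)

Section SupportedUnitaries.
Variables (R : realType) (n : nat).
Local Notation C := R[i].
Implicit Types (A B M U V : 'M[C]_n) (f : 'I_n -> nat) (S P Q : pred 'I_n).

Definition supp S A := forall i j, ~~ (S i && S j) -> A i j = (i == j)%:R.

(** The labelling [f] makes one notion serve for all groups involved: the block labels give [L] or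
    [H], a predicate gives a two-block group, a constant gives the full unitary group on [S], and an
    injective [f] gives diagonal matrices. *)
Definition supp_block f S : set 'M[C]_n :=
  [set A | [/\ unitary A, supp S A & forall i j, f i <> f j -> A i j = 0]]%classic.

Lemma supp1 S : supp S 1%:M.
Proof. by move=> i j _; rewrite mxE. Qed.

Lemma sub_supp S P A : (forall i, S i -> P i) -> supp S A -> supp P A.
Proof.
move=> sSP hA i j h; apply: hA; apply: contra h => /andP[/sSP -> /sSP ->] //.
Qed.

Lemma supp_adj S A : supp S A -> supp S (adjm A).
Proof. by move=> hA i j h; rewrite adjmE hA 1?andbC // rmorph_nat eq_sym. Qed.

Lemma supp_row S A i : supp S A -> ~~ S i -> row i A = delta_mx 0 i.
Proof. by move=> hA h; apply/rowP=> j; rewrite !mxE hA ?(negPf h) // eq_sym. Qed.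

Lemma suppM S A B : supp S A -> supp S B -> supp S (A *m B).
Proof.
move=> hA hB i j; rewrite negb_and => /orP[] h.
  have := congr1 (fun r => (r *m B) 0 j) (supp_row hA h).
  by rewrite /= -row_mul mxE => ->; rewrite -rowE mxE hB // (negPf h).
rewrite mxE (bigD1 j) //= hB ?(negPf h) ?andbF // eqxx mulr1 big1 => [|k kj].
  by rewrite addr0 hA // (negPf h) andbF.
by rewrite hB ?(negPf h) ?andbF // (negPf kj) mulr0.
Qed.

Lemma supp_mulE S A B i j : supp S B -> ~~ S j -> (A *m B) i j = A i j.
Proof.
move=> hB h; rewrite mxE (bigD1 j) //= hB ?(negPf h) ?andbF // eqxx mulr1.
rewrite big1 ?addr0 // => k kj.
by rewrite hB ?(negPf h) ?andbF // (negPf kj) mulr0.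
Qed.

Lemma supp_mulEl S A B i j : supp S A -> ~~ S i -> (A *m B) i j = B i j.
Proof.
move=> hA h; have := congr1 (fun r => (r *m B) 0 j) (supp_row hA h).
by rewrite /= -row_mul mxE => ->; rewrite -rowE mxE.
Qed.

(** Entrywise, both products agree with [A] if both indices lie in [S], with [B] if neither does,
    and vanish in the mixed case. *)
Lemma supp_comm S P A B : (forall i, S i -> ~~ P i) ->
  supp S A -> supp P B -> A *m B = B *m A.
Proof.
move=> dSP hA hB; apply/matrixP=> i j.
have dPS k : P k -> ~~ S k by move=> hk; apply/negP => /dSP; rewrite hk.
have [Sj|nSj] := boolP (S j); last first.
  rewrite [RHS](supp_mulE _ _ hA) //.
  have [Si|nSi] := boolP (S i); last by rewrite (supp_mulEl _ _ hA).
  rewrite (hB i) ?(negPf (dSP _ Si)) // mxE big1 => [|k _].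
    by rewrite (_ : i == j = false) //; apply: contraNF nSj => /eqP <-.
  have [Sk|nSk] := boolP (S k); last first.
    by rewrite hA ?(negPf nSk) ?andbF // (_ : i == k = false) ?mul0r //; apply: contraNF nSk => /eqP <-.
  by rewrite hB ?(negPf (dSP _ Sk)) // (_ : k == j = false) ?mulr0 //; apply: contraNF nSj => /eqP <-.
rewrite (supp_mulE _ _ hB) ?dSP //.
have [Si|nSi] := boolP (S i); first by rewrite (supp_mulEl _ _ hB) // dSP.
rewrite hA ?(negPf nSi) // mxE big1 => [|k _].
  by rewrite (_ : i == j = false) //; apply: contraNF nSi => /eqP ->.
have [Sk|nSk] := boolP (S k).
  by rewrite hB ?(negPf (dSP _ Sk)) ?andbF // (_ : i == k = false) ?mul0r //; apply: contraNF nSi => /eqP ->.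
by rewrite hA ?(negPf nSk) // (_ : k == j = false) ?mulr0 //; apply: contraNF nSk => /eqP ->.
Qed.

Lemma unitary_delta_col U a : unitary U -> row a U = delta_mx 0 a -> col a U = delta_mx a 0.
Proof.
move=> hU h; rewrite colE -adjm_delta -[X in X *m _](adjmK U) -adjmM.
rewrite -{1}h rowE -mulmxA (unitary_adjr hU) mulmx1 //.
Qed.

(** By unitarity the column [a] is a basis vector as soon as the row is, so the coordinate splits
    off. This is how each clearing step shrinks the support. *)
Lemma supp_reduce S U a : unitary U -> supp S U -> row a U = delta_mx 0 a ->
  supp (fun i => S i && (i != a)) U.
Proof.
move=> hU hS h i j; have hc := unitary_delta_col hU h.
have [-> _|ia] := eqVneq i a.
  by have /rowP/(_ j) := h; rewrite !mxE eqxx /= eq_sym.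
have [-> _|ja] := eqVneq j a.
  by have /colP/(_ i) := hc; rewrite !mxE eqxx andbT (negPf ia).
by rewrite !andbT; apply: hS.
Qed.

Lemma supp_block1 f S : supp_block f S 1%:M.
Proof.
split; [exact: unitary1|exact: supp1|move=> i j h; rewrite mxE].
by case: eqVneq => // e; rewrite e in h.
Qed.

Lemma supp_blockM f S A B :
  supp_block f S A -> supp_block f S B -> supp_block f S (A *m B).
Proof.
move=> [uA sA fA] [uB sB fB]; split; [exact: unitaryM|exact: suppM|].
move=> i j h; rewrite mxE big1 // => k _.
have [e|/eqP e] := eqVneq (f i) (f k); last by rewrite fA ?mul0r.
by rewrite fB ?mulr0 // -e.
Qed.

Lemma supp_block_adj f S A : supp_block f S A -> supp_block f S (adjm A).
Proof.
move=> [uA sA fA]; split; [exact: unitary_adj|exact: supp_adj|].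
by move=> i j h; rewrite adjmE fA ?conjC0 //; apply: nesym.
Qed.

Lemma sub_supp_block f g S P A : (forall i, S i -> P i) ->
    (forall i j, S i -> S j -> f i = f j -> g i = g j) ->
  supp_block f S A -> supp_block g P A.
Proof.
move=> sSP fg [uA sA fA]; split => //; first exact: sub_supp sA.
move=> i j h; have [/andP[Si Sj]|nS] := boolP (S i && S j).
  by apply: fA => /(fg _ _ Si Sj).
by rewrite sA //; case: eqVneq => // e; rewrite e in h.
Qed.

Definition restr P A : 'M[C]_n :=
  \matrix_(i, j) if P i && P j then A i j else (i == j)%:R.

(** The rows of [A] indexed by [P] have no entry outside [P], so cutting there loses nothing of
    their inner products. *)
Lemma supp_block_restr f S P A : supp_block f S A ->
    (forall i j, P i != P j -> A i j = 0) ->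
  supp_block f (fun i => S i && P i) (restr P A).
Proof.
move=> [uA sA fA] hP; split.
- apply/matrixP=> i j; rewrite -/(adjm _) [LHS]mxE [RHS]mxE.
  have [Pi|nPi] := boolP (P i); last first.
    rewrite (bigD1 i) //= adjmE !mxE !(negPf nPi, andbF) /= eqxx mul1r rmorph_nat.
    rewrite big1 ?addr0 1?eq_sym // => k ki.
    by rewrite mxE (negPf nPi) eq_sym (negPf ki) mul0r.
  have [Pj|nPj] := boolP (P j); last first.
    rewrite (bigD1 j) //= adjmE !mxE !(negPf nPj, andbF) /= eqxx rmorph_nat mulr1.
    rewrite big1 ?addr0 // => k kj.
    by rewrite adjmE !mxE (negPf nPj) [j == k]eq_sym (negPf kj) conjC0 mulr0.
  have /matrixP/(_ i j) := uA; rewrite !mxE => <-; apply: eq_bigr => k _.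
  rewrite adjmE !mxE Pi Pj /=; case: ifP => Pk //.
  by rewrite (hP i k) ?(hP j k) ?Pi ?Pj ?Pk // !mul0r (_ : i == k = false) ?mul0r //;
     apply: contraFF Pk => /eqP <-.
- move=> i j h; rewrite mxE; case: ifP => // /andP[Pi Pj].
  by apply: sA; apply: contra h => /andP[-> ->]; rewrite Pi.
- move=> i j h; rewrite mxE; case: ifP => _; first exact: fA.
  by case: eqVneq => // e; rewrite e in h.
Qed.

Lemma restr_split P A : (forall i j, P i != P j -> A i j = 0) ->
  A = restr P A *m restr (predC P) A.
Proof.
move=> hP; apply/matrixP=> i j; rewrite mxE.
have [Pi|nPi] := boolP (P i).
  have [Pj|nPj] := boolP (P j).
    rewrite (bigD1 j) //= !mxE /= Pi Pj /= eqxx mulr1 big1 ?addr0 // => k kj.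
    by rewrite !mxE /= Pj andbF (negPf kj) mulr0.
  rewrite hP ?Pi ?(negPf nPj) // big1 // => k _; rewrite !mxE /= Pi nPj andbT.
  case Pk: (P k) => /=; last by rewrite (_ : i == k = false) ?mul0r //; apply: contraFF Pk => /eqP <-.
  by rewrite (_ : k == j = false) ?mulr0 //; apply: contraNF nPj => /eqP <-.
rewrite (bigD1 i) //= !mxE /= (negPf nPi) /= eqxx mul1r big1 ?addr0 => [|k ki].
  case: ifPn => // /negPn Pj; rewrite hP ?Pj ?(negPf nPi) //.
  by rewrite (_ : i == j = false) //; apply: contraNF nPi => /eqP ->.
by rewrite !mxE (negPf nPi) /= eq_sym (negPf ki) mul0r.
Qed.

(** The matrix from [householder] acts only on coordinates where [w] and the target differ, and
    outside [S] both vanish. *)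
Lemma unitary_row_to_delta S (w : 'rV[C]_n) a :
    (forall i, ~~ S i -> w 0 i = 0) -> S a -> dotu w w = 1 ->
  exists2 M, supp_block (fun=> 0%N) S M & w *m M = delta_mx 0 a.
Proof.
move=> wS Sa w1; have [|M [uM wM hM]] := @householder R n w (delta_mx 0 a).
  by rewrite w1 dotu_deltar mxE !eqxx.
have aux k : ~~ S k -> w 0 k == (delta_mx 0 a : 'rV[C]_n) 0 k.
  move=> nSk; rewrite wS // mxE /=.
  by rewrite (_ : k == a = false) //; apply: contraNF nSk => /eqP ->.
exists M => //; split=> // i j; rewrite negb_and => h; apply: hM.
by case/orP: h => /aux -> //; rewrite orbT.
Qed.

(** Here the phases are removed: the number [c] is the norm of the [P] part of [w], so the target
    has the same norm as [w] and [householder] applies whatever the phase of [w 0 a]. *)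
Lemma unitary_block_to_delta (w : 'rV[C]_n) S P a : P a -> S a ->
    (forall i, ~~ S i -> P i -> w 0 i = 0) ->
  exists M (c : R), [/\ supp_block (fun=> 0%N) (fun i => S i && P i) M,
    0 <= c, forall i, ~~ P i -> (w *m M) 0 i = w 0 i &
    forall i, P i -> (w *m M) 0 i = (c%:C)%C * (i == a)%:R].
Proof.
move=> Pa Sa wS; have [|c c0 hc] := @ge0_real_sqr R (\sum_(i | P i) w 0 i * (w 0 i)^*).
  by rewrite sumr_ge0 // => i _; apply: mul_conjC_ge0.
pose y : 'rV[C]_n := \row_i if P i then (c%:C)%C * (i == a)%:R else w 0 i.
have cc : (c%:C)%C^* = (c%:C)%C :> C by apply/CrealP; rewrite complex_real.
have [|M [uM wM hM]] := @householder R n w y.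
  rewrite !dotuE (bigID P) [RHS](bigID P) /= hc; congr (_ + _).
    rewrite (bigD1 a) //= mxE Pa eqxx mulr1 cc big1 => [|i /andP[Pi ia]].
      by rewrite addr0 expr2 rmorphM.
    by rewrite mxE Pi (negPf ia) mulr0 mul0r.
  by apply: eq_bigr => i nPi; rewrite mxE (negPf nPi).
exists M, c; split=> //.
- split=> // i j; rewrite negb_and => h; apply: hM.
  have aux k : ~~ (S k && P k) -> w 0 k == y 0 k.
    rewrite mxE; case: ifP; last by rewrite eqxx.
    move=> Pk; rewrite andbT => nSk; rewrite wS //.
    by rewrite (_ : k == a = false) ?mulr0 //; apply: contraNF nSk => /eqP ->.
  by case/orP: h => /aux -> //; rewrite orbT.
- by move=> i Pi; rewrite wM mxE (negPf Pi).
- by move=> i Pi; rewrite wM mxE Pi.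
Qed.

End SupportedUnitaries.

(** * Angles measured in full turns *)

Section CircleAngles.
Variable R : realType.
Implicit Types x : R.

Lemma cossin_2pi_int x : x \is a Num.int ->
  cos (x * (pi *+ 2)) = 1 /\ sin (x * (pi *+ 2)) = 0.
Proof.
have nat_case (m : nat) :
    cos (m%:R * (pi *+ 2) : R) = 1 /\ sin (m%:R * (pi *+ 2) : R) = 0.
  rewrite mulr_natl -[_ *+ m]add0r (periodicn (@cosD2pi R)).
  by rewrite (periodicn (@sinD2pi R)) cos0 sin0.
move=> /intrP[[m|m] ->]; first exact: nat_case.
by rewrite NegzE mulrNz mulNr cosN sinN; have [-> ->] := nat_case m.+1; rewrite oppr0.
Qed.

(** For the fractional part [y], the double angle formula gives a zero of the sine at [y * pi],
    which lies in [0, pi); hence [y = 0]. *)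
Lemma cos_2pi_eq1 x : cos (x * (pi *+ 2)) = 1 -> x \is a Num.int.
Proof.
move=> cx; pose m : R := (Num.floor x)%:~R; pose y := x - m.
have mint : m \is a Num.int by apply: intr_int.
have [cm sm] := cossin_2pi_int mint.
have cy : cos (y * pi *+ 2) = 1.
  by rewrite -mulrnAr mulrBl cosB cm sm mulr1 mulr0 addr0.
have y0 : 0 <= y by rewrite subr_ge0 real_floor_le ?num_real.
have y1 : y < 1 by rewrite ltrBlDl /m; have := floorD1_gt x; rewrite intrD.
have [y_eq0|yn0] := eqVneq y 0.
  by have /eqP := y_eq0; rewrite subr_eq0 => /eqP ->.
have : 0 < sin (y * pi).
  apply: sin_gt0_pi; apply/andP; split; last by rewrite gtr_pMl ?pi_gt0.
  by rewrite mulr_gt0 ?pi_gt0 // lt_def yn0.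
have : sin (y * pi) ^+ 2 = 0 by move: cy; rewrite cos_mulr2n sin2cos2 => ?; lra.
by move/eqP; rewrite sqrf_eq0 => /eqP ->; rewrite ltxx.
Qed.

Lemma exists_angle (c s : R) : c ^+ 2 + s ^+ 2 = 1 ->
  exists t, cos (t * (pi *+ 2)) = c /\ sin (t * (pi *+ 2)) = s.
Proof.
move=> cs; have pi0 : pi *+ 2 != 0 :> R by rewrite mulrn_eq0 /= gt_eqF ?pi_gt0.
have c1 : -1 <= c <= 1 by apply/andP; split; nra.
have sE : sin (acos c) = `|s|.
  by rewrite sin_acos // -sqrtr_sqr; congr Num.sqrt; lra.
have cE : cos (acos c) = c by rewrite acosK // in_itv.
have [s0|s0] := leP 0 s.
  by exists (acos c / (pi *+ 2)); rewrite divfK // sE cE ger0_norm.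
exists (- acos c / (pi *+ 2)); rewrite divfK // sinN cosN sE cE ltr0_norm //.
by rewrite opprK.
Qed.

End CircleAngles.

(* [coord_continuous] of the library needs nonzero dimensions. *)
Lemma continuous_coord (T : topologicalType) m n (i : 'I_m) (j : 'I_n) :
  continuous (fun M : 'M[T]_(m, n) => M i j).
Proof.
move=> M A nA; exists (fun k l => [set y | (k, l) = (i, j) -> A y]).
  move=> k l; apply: (@filterS _ _ _ (if (k, l) == (i, j) then A else setT)).
    by move=> y /=; case: eqP.
  by case: eqP => [[-> ->] //|_]; apply: filterT.
by move=> N hN; apply: (hN i j).
Qed.

(** * The torus of simultaneous rotations in disjoint coordinate planes *)

Section RotationTorus.
Variables (R : realType) (n r : nat) (a b : 'I_r -> 'I_n).
Implicit Types (x y : 'rV[R]_r) (i j : 'I_n) (k : 'I_r).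

Definition swap_planes i : 'I_n :=
  if [pick k | i == a k] is Some k then b k else
  if [pick k | i == b k] is Some k then a k else i.

Definition angle x i : R :=
  if [pick k | i == a k] is Some k then x 0 k * (pi *+ 2) else
  if [pick k | i == b k] is Some k then - (x 0 k * (pi *+ 2)) else 0.

(** The plane numbered [k] is spanned by the coordinates [a k] and [b k]. Since [angle] changes sign
    under [swap_planes], a single formula covers both rows of each rotation and the fixed
    coordinates. Angles are multiplied by 2 pi so that the kernel is exactly the integer lattice, as
    [toral] requires. *)
Definition rotmx x : 'M[R]_n := \matrix_(i, j)
  (cos (angle x i) * (i == j)%:R + sin (angle x i) * (swap_planes i == j)%:R).

Definition rot_torus : set 'M[R]_n := range rotmx.

Hypotheses (injA : injective a) (injB : injective b) (disjAB : forall k l, a k != b l).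

Lemma pick_a k : [pick l | a k == a l] = Some k.
Proof. by case: pickP => [l /eqP /injA -> //|/(_ k)]; rewrite eqxx. Qed.

Lemma pick_b k : [pick l | b k == b l] = Some k.
Proof. by case: pickP => [l /eqP /injB -> //|/(_ k)]; rewrite eqxx. Qed.

Lemma pick_ba k : [pick l | b k == a l] = None.
Proof. by case: pickP => // l; rewrite eq_sym (negPf (disjAB _ _)). Qed.

Lemma swap_planes_a k : swap_planes (a k) = b k.
Proof. by rewrite /swap_planes pick_a. Qed.

Lemma swap_planes_b k : swap_planes (b k) = a k.
Proof. by rewrite /swap_planes pick_ba pick_b. Qed.

Lemma angle_a x k : angle x (a k) = x 0 k * (pi *+ 2).
Proof. by rewrite /angle pick_a. Qed.

Lemma angle_b x k : angle x (b k) = - (x 0 k * (pi *+ 2)).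
Proof. by rewrite /angle pick_ba pick_b. Qed.

Variant plane_spec i : Prop :=
  | PlaneA k of i = a k
  | PlaneB k of i = b k
  | PlaneNone of (forall k, i != a k) & (forall k, i != b k).

Lemma planeP i : plane_spec i.
Proof.
case: (pickP (fun k => i == a k)) => [k /eqP|nA]; first exact: PlaneA.
case: (pickP (fun k => i == b k)) => [k /eqP|nB]; first exact: PlaneB.
by apply: PlaneNone => k; rewrite ?nA ?nB.
Qed.

Lemma off_planes i : (forall k, i != a k) -> (forall k, i != b k) ->
  swap_planes i = i /\ forall x, angle x i = 0.
Proof.
rewrite /swap_planes /angle => nA nB.
case: pickP => [k|_]; first by rewrite (negPf (nA k)).
by case: pickP => [k|_]; first by rewrite (negPf (nB k)).
Qed.

Lemma swap_planesK i : swap_planes (swap_planes i) = i.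
Proof.
have [k ->|k ->|nA nB] := planeP i; rewrite ?(swap_planes_a, swap_planes_b) //.
by have [-> _] := off_planes nA nB; have [-> _] := off_planes nA nB.
Qed.

Lemma angle_swap x i : angle x (swap_planes i) = - angle x i.
Proof.
have [k ->|k ->|nA nB] := planeP i.
- by rewrite swap_planes_a angle_a angle_b.
- by rewrite swap_planes_b angle_a angle_b opprK.
- by have [-> ->] := off_planes nA nB; rewrite oppr0.
Qed.

Lemma angleD x y i : angle (x + y) i = angle x i + angle y i.
Proof.
rewrite /angle; case: pickP => [k _|_]; first by rewrite mxE mulrDl.
by case: pickP => [k _|_]; rewrite ?addr0 // mxE mulrDl opprD.
Qed.

Lemma angleN x i : angle (- x) i = - angle x i.
Proof.
rewrite /angle; case: pickP => [k _|_]; first by rewrite mxE mulNr.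
by case: pickP => [k _|_]; rewrite ?oppr0 // mxE mulNr.
Qed.

Lemma row_rotmx x i : row i (rotmx x) =
  cos (angle x i) *: delta_mx 0 i + sin (angle x i) *: delta_mx 0 (swap_planes i).
Proof.
by apply/rowP=> j; rewrite !mxE /= ![j == _]eq_sym.
Qed.

Lemma rotmxD x y : rotmx (x + y) = rotmx x *m rotmx y.
Proof.
apply/row_matrixP=> i; rewrite row_mul !row_rotmx mulmxDl -!scalemxAl -!rowE !row_rotmx.
rewrite angle_swap swap_planesK angleD sinD cosD cosN sinN.
rewrite !scalerDr !scalerA !scalerDl; apply/rowP=> j; rewrite !mxE; ring.
Qed.

Lemma rotmxN x : (rotmx x)^T = rotmx (- x).
Proof.
apply/matrixP=> i j; rewrite !mxE angleN cosN sinN eq_sym.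
have [->|ij] := eqVneq i j.
  (* At a fixed point of [swap_planes] the angle equals its own negative, so the sine terms
     vanish. *)
  have [e|_] := eqVneq (swap_planes j) j; last by rewrite !mulr0.
  have h : angle x j = - angle x j by rewrite -angle_swap e.
  have -> : angle x j = 0 by lra.
  by rewrite sin0 oppr0.
have -> : (swap_planes j == i) = (swap_planes i == j).
  by apply/eqP/eqP => <-; rewrite swap_planesK.
have [<-|_] := eqVneq (swap_planes i) j; last by rewrite !mulr0.
by rewrite angle_swap cosN sinN.
Qed.

Lemma rotmx0 : rotmx 0 = 1%:M.
Proof.
have angle0 i : angle 0 i = 0.
  by rewrite /angle; case: pickP => [k _|_]; [|case: pickP => [k _|_ //]];
     rewrite mxE mul0r ?oppr0.
by apply/matrixP=> i j; rewrite !mxE angle0 cos0 sin0 mul1r mul0r addr0.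
Qed.

Lemma orthogonal_rotmx x : Defs.orthogonal (rotmx x).
Proof. by rewrite /Defs.orthogonal rotmxN -rotmxD subrr rotmx0. Qed.

Lemma rotmx_eq1 x : rotmx x = 1%:M <-> (forall k, x 0 k \is a Num.int).
Proof.
split=> [h k|h].
  apply: cos_2pi_eq1; have /matrixP/(_ (a k) (a k)) := h.
  rewrite !mxE eqxx mulr1 swap_planes_a angle_a.
  by rewrite [b k == _]eq_sym (negPf (disjAB _ _)) mulr0 addr0.
apply/matrixP=> i j; rewrite !mxE; have [k ->|k ->|nA nB] := planeP i.
- rewrite angle_a; have [-> ->] := cossin_2pi_int (h k).
  by rewrite mul1r mul0r addr0.
- rewrite angle_b cosN sinN; have [-> ->] := cossin_2pi_int (h k).
  by rewrite oppr0 mul1r mul0r addr0.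
- by have [_ ->] := off_planes nA nB; rewrite cos0 sin0 mul1r mul0r addr0.
Qed.

Lemma continuous_angle i : continuous (fun x => angle x i).
Proof.
have coordC k c : continuous (fun x : 'rV[R]_r => x 0 k * c).
  move=> x; apply: (@continuousM _ _ (fun y : 'rV[R]_r => y 0 k)).
    exact: continuous_coord.
  exact: cst_continuous.
rewrite /angle; case: pickP => [k _|_] x; first exact: coordC.
case: pickP => [k _|_]; last exact: cst_continuous.
apply: (@continuousN _ _ _ (fun y : 'rV[R]_r => y 0 k * (pi *+ 2))).
exact: coordC.
Qed.

Lemma continuous_rotmx : continuous rotmx.
Proof.
move=> x A [P nP sPA].
have nearP i j : nbhs x (fun y => P i j (rotmx y i j)).
  have : {for x, continuous (fun y => rotmx y i j)}.
    have -> : (fun y => rotmx y i j) = (fun y => cos (angle y i) * (i == j)%:R +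
        sin (angle y i) * (swap_planes i == j)%:R).
      by apply/funext => y; rewrite mxE.
    apply: continuousD; apply: continuousM.
    - by apply: continuous_comp; [exact: continuous_angle|exact: continuous_cos].
    - exact: cst_continuous.
    - by apply: continuous_comp; [exact: continuous_angle|exact: continuous_sin].
    - exact: cst_continuous.
  by apply; apply: nP.
(* A neighbourhood of a matrix is given entry by entry; finitely many entries allow the
   intersection. *)
have : nbhs x (fun y => forall ij : 'I_n * 'I_n, P ij.1 ij.2 (rotmx y ij.1 ij.2)).
  apply: (@filter_forall _ _ (fun ij y => P ij.1 ij.2 (rotmx y ij.1 ij.2)) _
    (nbhs_filter x)) => -[i j].
  exact: nearP.
by apply: filterS => y hy; apply: sPA => i j; apply: (hy (i, j)).
Qed.

Lemma toral_rot_torus : toral r rot_torus.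
Proof.
exists rotmx; split=> //; [exact: continuous_rotmx|exact: rotmxD| |exact: rotmx_eq1].
exact: orthogonal_rotmx.
Qed.

Lemma rot_torusM A B : rot_torus A -> rot_torus B -> rot_torus (A *m B).
Proof. by move=> [x _ <-] [y _ <-]; exists (x + y) => //; rewrite rotmxD. Qed.

Lemma rot_torus1 : rot_torus 1%:M.
Proof. by exists 0 => //; rewrite rotmx0. Qed.

Lemma rot_torusT A : rot_torus A -> rot_torus A^T.
Proof. by move=> [x _ <-]; exists (- x) => //; rewrite rotmxN. Qed.

Lemma rotmx_off x i j : (forall k, (i != a k) && (i != b k)) ->
  rotmx x i j = (i == j)%:R.
Proof.
move=> h; have [_ hx] := @off_planes i (fun k => proj1 (andP (h k))) (fun k => proj2 (andP (h k))).
by rewrite mxE hx cos0 sin0 mul1r mul0r addr0.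
Qed.

End RotationTorus.

Definition plane_rot (R : realType) n (i j : 'I_n) (t : R) : 'M[R]_n :=
  rotmx (fun _ : 'I_1 => i) (fun=> j) (const_mx t).

Lemma row_plane_rot (R : realType) n (i j l : 'I_n) (t : R) : i != j ->
  row l (plane_rot i j t) =
    if l == i then cos (t * (pi *+ 2)) *: delta_mx 0 i + sin (t * (pi *+ 2)) *: delta_mx 0 j
    else if l == j then cos (t * (pi *+ 2)) *: delta_mx 0 j - sin (t * (pi *+ 2)) *: delta_mx 0 i
    else delta_mx 0 l.
Proof.
move=> ij; rewrite /plane_rot row_rotmx /angle /swap_planes.
have [->|li] := eqVneq l i.
  by case: pickP => [k _|/(_ 0)]; rewrite ?eqxx // mxE.
case: pickP => [//|_]; have [->|lj] := eqVneq l j.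
  by case: pickP => [k _|/(_ 0)]; rewrite ?eqxx // mxE cosN sinN scaleNr.
by case: pickP => [//|_]; rewrite cos0 sin0 scale1r scale0r addr0.
Qed.

(** The parameter is [t] at position [k] and zero elsewhere. Rotations found one plane at a time
    thus land in one common torus. *)
Lemma rot_torus_plane_rot (R : realType) n r (a b : 'I_r -> 'I_n) :
    injective a -> injective b -> (forall k l, a k != b l) ->
  forall k (t : R), rot_torus a b (plane_rot (a k) (b k) t).
Proof.
move=> injA injB dAB k t; exists (t *: delta_mx 0 k) => //.
apply/row_matrixP=> l; rewrite row_plane_rot // row_rotmx.
have dE k' : (t *: delta_mx 0 k : 'rV[R]_r) 0 k' = t * (k' == k)%:R by rewrite !mxE.
have [m ->|m ->|nA nB] := planeP a b l.
- rewrite angle_a // swap_planes_a // dE (inj_eq injA).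
  have [->|mk] := eqVneq m k; first by rewrite mulr1.
  by rewrite (negPf (dAB _ _)) mulr0 mul0r cos0 sin0 scale1r scale0r addr0.
- rewrite angle_b // swap_planes_b // dE [b m == a k]eq_sym (negPf (dAB _ _)) (inj_eq injB).
  have [->|mk] := eqVneq m k; first by rewrite mulr1 cosN sinN scaleNr.
  by rewrite mulr0 mul0r oppr0 cos0 sin0 scale1r scale0r addr0.
- have [-> ->] := off_planes R nA nB.
  by rewrite (negPf (nA _)) (negPf (nB _)) cos0 sin0 scale1r scale0r addr0.
Qed.

(** * Real rotations as unitary matrices *)

Section Complexification.
Variables (R : realType) (n : nat).
Implicit Types (A B : 'M[R]_n).

Lemma cplx_mxM A B : cplx_mx (A *m B) = cplx_mx A *m cplx_mx B.
Proof. exact: (map_mxM (real_complex R)). Qed.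

Lemma cplx_mx1 : cplx_mx 1%:M = 1%:M :> 'M[R[i]]_n.
Proof. exact: (map_mx1 (real_complex R)). Qed.

Lemma conj_real (x : R) : (x%:C%C)^* = x%:C%C :> R[i].
Proof. by apply/CrealP; rewrite complex_real. Qed.

Lemma adjm_cplx_mx A : adjm (cplx_mx A) = cplx_mx A^T.
Proof. by apply/matrixP=> i j; rewrite adjmE !mxE conj_real. Qed.

Lemma unitary_cplx_mx A : Defs.orthogonal A -> unitary (cplx_mx A).
Proof. by move=> h; rewrite /unitary -/(adjm _) adjm_cplx_mx -cplx_mxM h cplx_mx1. Qed.

Lemma supp_cplx_rot_torus r (a b : 'I_r -> 'I_n) A : rot_torus a b A ->
  supp (fun i => [exists k, (i == a k) || (i == b k)]) (cplx_mx A).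
Proof.
move=> [x _ <-] i j; rewrite mxE => h.
suff -> : rotmx a b x i j = (i == j)%:R by case: eqP; rewrite ?rmorph1 ?rmorph0.
have off l : ~~ [exists k, (l == a k) || (l == b k)] ->
    forall k, (l != a k) && (l != b k).
  by move=> /existsPn hl k; rewrite -negb_or; apply: hl.
move: h; rewrite negb_and => /orP[/off hi|/off hj]; first exact: rotmx_off.
rewrite mxE; have [->|ij] := eqVneq i j.
  have [-> ->] := off_planes R (fun k => proj1 (andP (hj k))) (fun k => proj2 (andP (hj k))).
  by rewrite cos0 sin0 mul1r mul0r addr0.
rewrite mulr0 add0r (_ : swap_planes a b i == j = false) ?mulr0 //.
apply/negP => /eqP e; move: ij hj; rewrite -e /swap_planes.
case: pickP => [k _ _ /(_ k)|_]; first by rewrite eqxx andbF.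
case: pickP => [k _ _ /(_ k)|_]; first by rewrite eqxx.
by rewrite eqxx.
Qed.

Section PlaneRot.
Variables (a b : 'I_n) (ab : a != b).

Let ab_rot (t : R) : rot_torus (fun _ : 'I_1 => a) (fun=> b) (plane_rot a b t).
Proof. by exists (const_mx t). Qed.

Let injc (c : 'I_n) : injective (fun _ : 'I_1 => c).
Proof. by move=> i j _; rewrite !ord1. Qed.

Lemma supp_plane_rot (t : R) : supp (pred2 a b) (cplx_mx (plane_rot a b t)).
Proof.
apply: sub_supp (supp_cplx_rot_torus (ab_rot t)) => i /existsP[k hk].
exact: hk.
Qed.

Lemma orthogonal_plane_rot (t : R) : Defs.orthogonal (plane_rot a b t).
Proof. by apply: orthogonal_rotmx; [exact: injc|exact: injc|]. Qed.

Lemma tr_plane_rot (t : R) : (plane_rot a b t)^T = plane_rot a b (- t).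
Proof.
rewrite /plane_rot rotmxN; [|exact: injc|exact: injc|by []].
by congr rotmx; apply/rowP => i; rewrite !mxE.
Qed.

End PlaneRot.

Lemma plane_rotC (a b : 'I_n) (t : R) : a != b -> plane_rot a b (- t) = plane_rot b a t.
Proof.
move=> ab; have ba : b != a by rewrite eq_sym.
apply/row_matrixP => l; rewrite !row_plane_rot // mulNr cosN sinN scaleNr.
have [->|la] := eqVneq l a; first by rewrite (negPf ab).
by have [_|_] := eqVneq l b; rewrite ?scaleNr ?opprK.
Qed.

End Complexification.

(** * Clearing one row or one column *)

Section ClearingSteps.
Variables (R : realType) (n : nat).
Local Notation C := R[i].
Local Notation rot a b t := (cplx_mx (plane_rot a b t)).
Implicit Types (g M N : 'M[C]_n) (f : 'I_n -> nat) (S : pred 'I_n).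

Lemma exists_plane_rot (a b : 'I_n) (c s : R) : a != b -> c ^+ 2 + s ^+ 2 = 1 ->
  exists t, row a (rot a b t) =
    (c%:C)%C *: delta_mx 0 a + (s%:C)%C *: delta_mx 0 b.
Proof.
move=> ab /exists_angle[t [ct st]]; exists t.
have := row_plane_rot a t ab; rewrite eqxx ct st => /rowP h.
apply/rowP => j; have := h j; rewrite !mxE => ->.
by rewrite rmorphD !rmorphM !rmorph_nat.
Qed.

(** On [S] only two blocks are present, so a block unitary [M1 *m M2] on the right brings row [a] to
    a real unit vector on [a] and [b]. This is also row [a] of a plane rotation, and dividing by
    that rotation leaves a basis vector. *)
Lemma clear_row f S g a b : unitary g -> supp S g -> S a -> S b -> f a <> f b ->
    (forall j, S j -> f j = f a \/ f j = f b) ->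
  exists M N t, [/\ g = M *m rot a b t *m N, unitary M,
    supp (fun i => S i && (i != a)) M & supp_block f S N].
Proof.
move=> ug sg Sa Sb fab fS; have ab : a != b by apply: contra_notN fab => /eqP ->.
have rowS i : ~~ S i -> row a g 0 i = 0.
  move=> nSi; rewrite mxE sg ?negb_and ?nSi ?orbT //.
  by case: eqVneq nSi => // <-; rewrite Sa.
have [||i nSi _|M1 [c [uM1 c0 M1off M1on]]] :=
  @unitary_block_to_delta R n (row a g) S (fun i => f i == f a) a => //.
  exact: rowS.
have [||i nSi /eqP fi|M2 [s [uM2 s0 M2off M2on]]] :=
  @unitary_block_to_delta R n (row a g *m M1) S (fun i => f i == f b) b => //.
  by rewrite M1off ?rowS // fi; apply/eqP => /esym.
set w := row a g *m M1 *m M2 in M2off M2on.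
have wE : w = (c%:C)%C *: delta_mx 0 a + (s%:C)%C *: delta_mx 0 b.
  have rhsE i : ((c%:C)%C *: delta_mx 0 a + (s%:C)%C *: delta_mx 0 b : 'rV[C]_n) 0 i =
      (c%:C)%C * (i == a)%:R + (s%:C)%C * (i == b)%:R by rewrite !mxE.
  apply/rowP => i; rewrite rhsE; have [fb|/eqP fb] := eqVneq (f i) (f b).
    rewrite M2on ?fb // (_ : i == a = false) ?mulr0 ?add0r //.
    by apply: contra_notF fab => /eqP <-.
  rewrite M2off; last exact/eqP.
  rewrite [i == b](_ : _ = false) ?mulr0 ?addr0; last first.
    by apply: contra_notF fb => /eqP ->.
  have [fa|/eqP fa] := eqVneq (f i) (f a); first by rewrite M1on ?fa.
  rewrite M1off; last exact/eqP.
  rewrite [i == a](_ : _ = false); last by apply: contra_notF fa => /eqP ->.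
  by rewrite mulr0; apply: rowS; apply/negP => /fS [].
have [u1 _ _] := uM1; have [u2 _ _] := uM2.
have cs : c ^+ 2 + s ^+ 2 = 1.
  have : dotu w w = 1.
    rewrite /w !dotuM // rowE dotuM // dotu_deltar mxE !eqxx //.
  rewrite wE dotuE (bigD1 a) //= (bigD1 b) 1?eq_sym //= big1 => [|i /andP[ia ib]].
    rewrite !mxE !eqxx (negPf ab) eq_sym (negPf ab) !mulr0 !mulr1 !addr0 add0r !conj_real.
    by move=> h; apply: complexI; rewrite rmorphD !rmorphXn /= !expr2.
  by rewrite !mxE /= (negPf ia) (negPf ib) !mulr0 addr0 mul0r.
have [t ht] := exists_plane_rot ab cs.
have uN : supp_block f S (M1 *m M2).
  apply: supp_blockM; [apply: sub_supp_block uM1|apply: sub_supp_block uM2].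
  - by move=> i /andP[].
  - by move=> i j /andP[_ /eqP ->] /andP[_ /eqP ->].
  - by move=> i /andP[].
  - by move=> i j /andP[_ /eqP ->] /andP[_ /eqP ->].
have uR : unitary (rot a b t) by apply/unitary_cplx_mx/orthogonal_plane_rot.
have [uN1 sN1 _] := uN.
have sR : supp S (rot a b t).
  by apply: (sub_supp _ (supp_plane_rot t)) => i /orP[] /eqP ->.
have uM : unitary (g *m (M1 *m M2) *m adjm (rot a b t)).
  by apply: unitaryM; [exact: unitaryM|exact: unitary_adj].
exists (g *m (M1 *m M2) *m adjm (rot a b t)), (adjm (M1 *m M2)), t; split=> //.
- rewrite -[g *m _ *m _ *m _]mulmxA unitary_adjl // mulmx1 -mulmxA.
  by rewrite unitary_adjr // mulmx1.
(* Row [a] of [g *m (M1 *m M2)] is row [a] of the rotation, so the inverse rotation sends it to the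
   basis vector at [a]. *)
- apply: supp_reduce => //.
    by apply: suppM; [exact: suppM|exact: supp_adj].
  rewrite row_mul row_mul mulmxA -/w wE -ht rowE -mulmxA.
  by rewrite unitary_adjr // mulmx1.
- exact: supp_block_adj.
Qed.

(** This is [clear_row] for the adjoint. Transposition reverses the rotation, which amounts to
    exchanging the two axes; hence [b a] in place of [a b]. *)
Lemma clear_col f S g a b : unitary g -> supp S g -> S a -> S b -> f a <> f b ->
    (forall j, S j -> f j = f a \/ f j = f b) ->
  exists M N t, [/\ g = N *m rot b a t *m M, unitary M,
    supp (fun i => S i && (i != a)) M & supp_block f S N].
Proof.
move=> ug sg Sa Sb fab fS; have ab : a != b by apply: contra_notN fab => /eqP ->.
have [M [N [t [e uM sM hN]]]] := @clear_row f S (adjm g) a b (unitary_adj ug)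
  (supp_adj sg) Sa Sb fab fS.
exists (adjm M), (adjm N), t; split.
- rewrite -(adjmK g) e !adjmM adjm_cplx_mx tr_plane_rot // plane_rotC //.
  by rewrite mulmxA.
- exact: unitary_adj.
- exact: supp_adj.
- exact: supp_block_adj.
Qed.

End ClearingSteps.

(** * Unit vectors, eigenvectors and coordinate projections *)

Section UnitVectors.
Variable R : realType.
Local Notation C := R[i].

Lemma normalize n (v : 'rV[C]_n) : v != 0 ->
  exists2 c : R, c != 0 & dotu ((c%:C)%C *: v) ((c%:C)%C *: v) = 1.
Proof.
move=> v0; have [c c0 hc] := ge0_real_sqr (dotu_ge0 v).
have cn0 : c != 0.
  by apply: contraNneq v0 => e; rewrite -dotu_eq0 hc e expr0n.
exists c^-1; rewrite ?invr_eq0 // dotuZl dotuZr conj_real hc !rmorphXn fmorphV /=.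
by rewrite expr2 mulrA mulrACA mulVf ?mul1r ?mulr1 ?mulVf // fmorph_eq0.
Qed.

Lemma exists_eigenvector r (A : 'M[C]_r.+1) :
  exists (v : 'rV[C]_r.+1) (z : C), v != 0 /\ v *m A = z *: v.
Proof.
have [|z] := closed_rootP (char_poly A) _.
  by rewrite size_char_poly.
by rewrite -eigenvalue_root_char => /eigenvalueP[v vA v0]; exists v, z.
Qed.

Definition coord_proj n (P : pred 'I_n) : 'M[C]_n := diag_mx (\row_j (P j)%:R).

Lemma coord_projE m n (P : pred 'I_n) (A : 'M[C]_(m, n)) i j :
  (A *m coord_proj P) i j = A i j * (P j)%:R.
Proof. by rewrite mul_mx_diag !mxE. Qed.

Lemma dotu_coord_proj n (P : pred 'I_n) (w z : 'rV[C]_n) :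
  dotu w z = dotu (w *m coord_proj P) (z *m coord_proj P) +
             dotu (w *m coord_proj (predC P)) (z *m coord_proj (predC P)).
Proof.
rewrite !dotuE -big_split /=; apply: eq_bigr => j _; rewrite !coord_projE /=.
by case: (P j); rewrite !(mulr1, mulr0, conjC0, addr0, add0r).
Qed.

Lemma coord_proj_split n (P : pred 'I_n) (w : 'rV[C]_n) :
  w = w *m coord_proj P + w *m coord_proj (predC P).
Proof.
apply/rowP => j; rewrite [RHS]mxE !coord_projE /=.
by case: (P j); rewrite !(mulr1, mulr0, addr0, add0r).
Qed.

(* When [p0 = 0] the direction [u] comes from a dimension count: there are
   only [r] orthogonality conditions on the [r.+1] coordinates [a k]. *)
Lemma exists_unit_direction n r (P : pred 'I_n) (a : 'I_r.+1 -> 'I_n)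
    (p0 : 'rV[C]_n) (p : 'I_r -> 'rV[C]_n) :
    injective a -> (forall k, P (a k)) -> (forall i, ~~ P i -> p0 0 i = 0) ->
    (forall l, dotu (p l) p0 = 0) ->
  exists (u : 'rV[C]_n) (c : R), [/\ dotu u u = 1, forall i, ~~ P i -> u 0 i = 0,
    p0 = (c%:C)%C *: u & forall l, dotu (p l) u = 0].
Proof.
move=> injA Pa p0P orth; have [p00|p0n0] := eqVneq p0 0; last first.
  have [c c0 h] := normalize p0n0; exists ((c%:C)%C *: p0), c^-1; split=> //.
  - by move=> i nPi; rewrite mxE p0P // mulr0.
  - by rewrite scalerA -rmorphM mulVf // rmorph1 scale1r.
  - by move=> l; rewrite dotuZr orth mulr0.
pose K : 'M[C]_(r.+1, r) := \matrix_(k, l) (p l 0 (a k))^*.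
have kerK : kermx K != 0.
  rewrite -mxrank_eq0 mxrank_ker subn_eq0 -ltnNge ltnS.
  exact: rank_leq_col.
have [k0 hk0] : exists k0, row k0 (kermx K) != 0.
  apply/existsP; apply: contraR kerK; rewrite negb_exists => /forallP h.
  by apply/eqP/row_matrixP => i; have := h i; rewrite negbK row0 => /eqP.
pose y := row k0 (kermx K).
pose u0 : 'rV[C]_n := \sum_k y 0 k *: delta_mx 0 (a k).
have u0E i : u0 0 i = \sum_k y 0 k * (i == a k)%:R.
  by rewrite /u0 summxE; apply: eq_bigr => k _; rewrite !mxE eqxx.
have u0a k : u0 0 (a k) = y 0 k.
  rewrite u0E (bigD1 k) //= eqxx mulr1 big1 ?addr0 // => k' kk'.
  by rewrite (inj_eq injA) eq_sym (negPf kk') mulr0.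
have u0n0 : u0 != 0.
  apply: contraNneq hk0 => e; apply/eqP/rowP => k.
  by rewrite -/y -u0a e !mxE.
have [c c0 h] := normalize u0n0; exists ((c%:C)%C *: u0), 0; split=> //.
- move=> i nPi; rewrite mxE u0E big1 ?mulr0 // => k _.
  by rewrite (_ : i == a k = false) ?mulr0 //; apply: contraNF nPi => /eqP ->.
- by rewrite p00 rmorph0 scale0r.
- move=> l; rewrite dotuZr -dotuC; suff -> : dotu u0 (p l) = 0 by rewrite conjC0 mulr0.
  have : (y *m K) 0 l = 0 by rewrite /y -row_mul mulmx_ker !mxE.
  rewrite mxE => <-; rewrite dotuE.
  transitivity (\sum_i \sum_k y 0 k * (i == a k)%:R * (p l 0 i)^*).
    by apply: eq_bigr => i _; rewrite u0E mulr_suml.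
  rewrite exchange_big /=; apply: eq_bigr => k _.
  rewrite (bigD1 (a k)) //= eqxx mulr1 big1 ?addr0 ?mxE // => i ik.
  by rewrite (negPf ik) mulr0 mul0r.
Qed.

Lemma supp_row_id n (S : pred 'I_n) (A : 'M[C]_n) (u : 'rV[C]_n) :
  supp S A -> (forall i, S i -> u 0 i = 0) -> u *m A = u.
Proof.
move=> sA hu; apply/rowP => j; rewrite mxE (bigD1 j) //=.
have [Sj|nSj] := boolP (S j); last first.
  rewrite sA ?(negPf nSj) ?andbF // eqxx mulr1 big1 ?addr0 // => k kj.
  by rewrite sA ?(negPf nSj) ?andbF // (negPf kj) mulr0.
rewrite hu // mul0r add0r big1 // => k kj.
have [/hu ->|nSk] := boolP (S k); first by rewrite mul0r.
by rewrite sA ?(negPf nSk) // (negPf kj) mulr0.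
Qed.

End UnitVectors.

(** * The generalized CS decomposition for two blocks on each side *)

Section GeneralizedCS.
Variables (R : realType) (n : nat).
Local Notation C := R[i].
Local Notation rot a b t := (cplx_mx (plane_rot a b t)).

(** Clearing row [a ord0] alone would remove one coordinate. The eigenvector makes the same element
    of [H] also clear the columns [a ord0] and [b ord0] in the other rows of [I]; after the
    rotation, column [b ord0] lives outside [I] and can be cleared by [L], so that a whole plane
    splits off. *)
Lemma cs_step r (S I J : pred 'I_n) (a b : 'I_r.+1 -> 'I_n) (g : 'M[C]_n) :
    injective a -> injective b ->
    (forall k, [/\ S (a k) & J (a k)]) ->
    (forall k, [/\ S (b k), ~~ I (b k) & ~~ J (b k)]) ->
    (forall i, S i -> I i = [exists k, i == a k]) ->
    unitary g -> supp S g ->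
  exists X G H t,
    [/\ supp_block I S X, supp_block J S H, unitary G,
        supp (fun i => [&& S i, i != a ord0 & i != b ord0]) G &
        g = X *m G *m rot (a ord0) (b ord0) t *m H].
Proof.
move=> injA injB Sa Sb SI ug sg.
set a0 := a ord0; set b0 := b ord0.
have [Sa0 Ja0] := Sa ord0; have [Sb0 nIb0 nJb0] := Sb ord0.
have Ia k : I (a k) by have [Sk _] := Sa k; rewrite SI //; apply/existsP; exists k.
have a0b0 : a0 != b0 by apply: contraNneq nJb0; rewrite -/b0 => <-.
pose E : 'M[C]_(r.+1, n) := rowsub a 1%:M.
have EE : E *m adjm E = 1%:M.
  apply/matrixP => k l; rewrite !mxE (bigD1 (a l)) //= adjmE !mxE eqxx (inj_eq injA).
  rewrite rmorph1 mulr1 big1 ?addr0 // => i il.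
  by rewrite adjmE !mxE [a l == i]eq_sym (negPf il) conjC0 mulr0.
have dotuE_E (y z : 'rV[C]_r.+1) : dotu (y *m E) (z *m E) = dotu y z.
  by rewrite /dotu adjmM mulmxA -(mulmxA y) EE mulmx1.
have factorE (u : 'rV[C]_n) : (forall i, ~~ (S i && I i) -> u 0 i = 0) ->
    u = (\row_k u 0 (a k)) *m E.
  move=> hu; apply/rowP => i; rewrite mxE.
  have [/andP[Si Ii]|nSI] := boolP (S i && I i); last first.
    rewrite hu // big1 // => k _; rewrite !mxE (_ : a k == i = false) ?mulr0 //.
    by apply: contraNF nSI => /eqP <-; have [-> _] := Sa k; rewrite Ia.
  move: Ii; rewrite SI // => /existsP[k0 /eqP ->].
  rewrite (bigD1 k0) //= !mxE eqxx mulr1 big1 ?addr0 // => k kk0.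
  by rewrite !mxE (inj_eq injA) (negPf kk0) mulr0.
have Esupp (y : 'rV[C]_r.+1) i : ~~ (S i && I i) -> (y *m E) 0 i = 0.
  move=> nSI; rewrite mxE big1 // => k _; rewrite !mxE (_ : a k == i = false) ?mulr0 //.
  by apply: contraNF nSI => /eqP <-; have [-> _] := Sa k; rewrite Ia.
pose D := E *m g *m coord_proj R J.
have [v0 [z [v0n0 v0eig]]] := exists_eigenvector (D *m adjm D).
have [c1 c1n0 v1] := normalize v0n0.
set v := (c1%:C)%C *: v0 in v1.
have veig : v *m (D *m adjm D) = z *: v.
  by rewrite /v -scalemxAl v0eig !scalerA mulrC.
(* As [D *m adjm D] is self-adjoint, the left eigenvector [v] gives a right eigenvector [adjm v], so
   the product is a multiple of [dotu y v]. *)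
have orthD (y : 'rV[C]_r.+1) : dotu y v = 0 -> dotu (y *m D) (v *m D) = 0.
  move=> yv; rewrite /dotu adjmM -mulmxA [D *m _]mulmxA.
  rewrite -[D *m adjm D]adjmK adjmM adjmK -adjmM veig adjmZ -scalemxAr mxE.
  by rewrite -/(dotu y v) yv mulr0.
have [|||M1 uM1 vM1] := @unitary_row_to_delta R n (fun i => S i && I i) (v *m E) a0.
- exact: Esupp.
- by rewrite Sa0 Ia.
- by rewrite dotuE_E.
have [u1 s1 _] := uM1.
pose g1 := adjm M1 *m g.
have rowX : row a0 (adjm M1) = v *m E.
  by rewrite rowE -vM1 -mulmxA unitary_adjr // mulmx1.
have row0g1 : row a0 g1 = v *m E *m g by rewrite row_mul rowX.
have ug1 : unitary g1 by apply: unitaryM => //; apply: unitary_adj.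
have sg1 : supp S g1.
  by apply: suppM => //; apply/supp_adj/(sub_supp _ s1) => i /andP[].
pose q l := row (a (lift ord0 l)) g1.
have qE l : exists2 y, q l = y *m E *m g & dotu y v = 0.
  set i := a (lift ord0 l).
  have hu : forall j, ~~ (S j && I j) -> (row i (adjm M1)) 0 j = 0.
    move=> j nSI; rewrite mxE (supp_adj s1); last by rewrite (negPf nSI) andbF.
    rewrite (_ : i == j = false) //; apply: contraNF nSI => /eqP <-.
    by rewrite /i; have [-> _] := Sa (lift ord0 l); rewrite Ia.
  exists (\row_k (row i (adjm M1)) 0 (a k)); first by rewrite -factorE // /q row_mul.
  rewrite -dotuE_E -factorE // -rowX !rowE dotuM ?dotu_deltar; last exact: unitary_adj.
  by rewrite mxE eqxx /= /i (inj_eq injA) (negPf (neq_lift _ _)).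
have orthJ l : dotu (q l *m coord_proj R J) (row a0 g1 *m coord_proj R J) = 0.
  by have [y -> yv] := qE l; rewrite row0g1 -!(mulmxA _ E) -!(mulmxA _ (E *m g)) orthD.
(* Whole rows of the unitary [g1] are orthogonal; subtracting the [J] parts leaves the parts outside
   [J]. *)
have orthJC l : dotu (q l *m coord_proj R (predC J)) (row a0 g1 *m coord_proj R (predC J)) = 0.
  have := dotu_coord_proj J (q l) (row a0 g1); rewrite orthJ add0r => <-.
  rewrite /q !rowE dotuM // dotu_deltar mxE eqxx /= (inj_eq injA).
  by rewrite (negPf (neq_lift _ _)).
have g1S j : ~~ S j -> row a0 g1 0 j = 0.
  move=> nSj; rewrite mxE sg1 ?(negPf nSj) ?andbF //.
  by rewrite (_ : a0 == j = false) //; apply: contraNF nSj => /eqP <-.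
(* There are [r] other rows to be orthogonal to, and [r.+1] coordinates [a k] in [J]. The [b k]
   offer as many outside [J] for the second direction [w]. *)
have [|i||u [c [u_1 uS p0E u_orth]]] := exists_unit_direction
  (P := fun i => S i && J i) (p0 := row a0 g1 *m coord_proj R J)
  (p := fun l => q l *m coord_proj R J) injA.
- by move=> k; have [-> ->] := Sa k.
- rewrite coord_projE negb_and => /orP[/g1S ->|/negPf ->]; first by rewrite mul0r.
  by rewrite mulr0.
- exact: orthJ.
have [|i||w [s [w_1 wS q0E w_orth]]] := exists_unit_direction
  (P := fun i => S i && ~~ J i) (p0 := row a0 g1 *m coord_proj R (predC J))
  (p := fun l => q l *m coord_proj R (predC J)) injB.
- by move=> k; have [-> _ ->] := Sb k.
- rewrite coord_projE negb_and => /orP[/g1S ->|]; first by rewrite mul0r.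
  by rewrite negbK /= => ->; rewrite mulr0.
- exact: orthJC.
have row0E : row a0 g1 = (c%:C)%C *: u + (s%:C)%C *: w.
  by rewrite -p0E -q0E -coord_proj_split.
have [|||H1 uH1 huH1] := @unitary_row_to_delta R n (fun i => S i && J i) u a0 => //.
  by rewrite Sa0.
have [|||H2 uH2 hwH2] := @unitary_row_to_delta R n (fun i => S i && ~~ J i) w b0 => //.
  by rewrite Sb0.
have [unH1 sH1 _] := uH1; have [unH2 sH2 _] := uH2.
pose H := H1 *m H2.
have uH : u *m H = delta_mx 0 a0.
  rewrite /H mulmxA huH1 (supp_row_id sH2) // => i /andP[_ nJ].
  rewrite mxE (_ : i == a0 = false) ?andbF //.
  by apply: contraNF nJ => /eqP ->.
have wH : w *m H = delta_mx 0 b0.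
  rewrite /H mulmxA (supp_row_id sH1) // => i /andP[Si Ji].
  by rewrite wS // Si Ji.
have unH : unitary H by apply: unitaryM.
have sbH : supp_block J S H.
  by apply: supp_blockM; [apply: sub_supp_block uH1|apply: sub_supp_block uH2];
    [move=> i /andP[]|move=> i j /andP[_ ->] /andP[_ ->]|
     move=> i /andP[]|move=> i j /andP[_ /negPf ->] /andP[_ /negPf ->]].
pose g2 := g1 *m H.
have ug2 : unitary g2 by apply: unitaryM.
have row0g2 : row a0 g2 = (c%:C)%C *: delta_mx 0 a0 + (s%:C)%C *: delta_mx 0 b0.
  by rewrite row_mul row0E mulmxDl -!scalemxAl uH wH.
have dot_sub (P : pred 'I_n) (x y : 'rV[C]_n) : (forall i, ~~ P i -> y 0 i = 0) ->
    dotu (x *m coord_proj R P) y = dotu x y.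
  move=> hy; rewrite !dotuE; apply: eq_bigr => i _; rewrite coord_projE.
  by have [_|/hy ->] := boolP (P i); rewrite ?mulr1 // conjC0 !mulr0.
have g2E i j : g2 i j = dotu (row i g2) (delta_mx 0 j) by rewrite dotu_deltar [RHS]mxE.
(* Since [H] sends [u] to the basis vector at [a0], this entry is the inner product of the row [q l]
   with [u]. *)
have g2a l : g2 (a (lift ord0 l)) a0 = 0.
  rewrite g2E row_mul -uH dotuM // -(u_orth l) dot_sub // => i nJi.
  by apply: uS; rewrite negb_and nJi orbT.
have g2b l : g2 (a (lift ord0 l)) b0 = 0.
  rewrite g2E row_mul -wH dotuM // -(w_orth l) dot_sub // => i nJi.
  by apply: wS; rewrite negb_and /=; move: nJi => /= ->; rewrite orbT.
have cs1 : c ^+ 2 + s ^+ 2 = 1.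
  have : dotu (row a0 g2) (row a0 g2) = 1 by rewrite rowE dotuM // dotu_deltar mxE !eqxx.
  rewrite row0g2 dotuE (bigD1 a0) //= (bigD1 b0) 1?eq_sym //= big1 => [|i /andP[ia ib]].
    rewrite !mxE !eqxx (negPf a0b0) eq_sym (negPf a0b0) !mulr0 !mulr1 !addr0 add0r !conj_real.
    by move=> h; apply: complexI; rewrite rmorphD !rmorphXn /= !expr2.
  by rewrite !mxE /= (negPf ia) (negPf ib) !mulr0 addr0 mul0r.
have [t ht] := exists_plane_rot a0b0 cs1.
have uR : unitary (rot a0 b0 t) by apply/unitary_cplx_mx/orthogonal_plane_rot.
have sR := @supp_plane_rot R n a0 b0 t.
pose g3 := g2 *m adjm (rot a0 b0 t).
have ug3 : unitary g3 by apply: unitaryM => //; apply: unitary_adj.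
have sg3 : supp S g3.
  apply: suppM; first by apply: suppM => //; have [] := sbH.
  by apply: supp_adj; apply: sub_supp sR => i /orP[] /eqP ->.
have row0g3 : row a0 g3 = delta_mx 0 a0.
  by rewrite row_mul row0g2 -ht rowE -mulmxA unitary_adjr // mulmx1.
(* The rotation mixes only the columns [a0] and [b0], both of which are zero in the other rows of
   [I]. *)
have g3b i : S i -> I i -> g3 i b0 = 0.
  move=> Si; rewrite SI // => /existsP[k /eqP ->].
  have [l ->|->] := unliftP ord0 k; last first.
    by have /rowP/(_ b0) := row0g3; rewrite !mxE eqxx eq_sym (negPf a0b0).
  rewrite mxE big1 // => j _; rewrite adjmE.
  have [->|ja] := eqVneq j a0; first by rewrite g2a mul0r.
  have [->|jb] := eqVneq j b0; first by rewrite g2b mul0r.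
  rewrite sR ?(negPf ja) ?(negPf jb) ?andbF /= ?(negPf ja) ?(negPf jb) ?andbF //.
  by rewrite eq_sym (negPf jb) conjC0 mulr0.
have [||| M4 uM4 hM4] := @unitary_row_to_delta R n (fun i => S i && ~~ I i) (row b0 (adjm g3)) b0.
- move=> i; rewrite negb_and mxE adjmE => h.
  have [Si|nSi] := boolP (S i).
    by rewrite g3b ?conjC0 //; move: h; rewrite Si negbK.
  rewrite sg3 ?(negPf nSi) // (_ : i == b0 = false) ?conjC0 //.
  by apply: contraNF nSi => /eqP ->.
- by rewrite Sb0.
- by rewrite rowE dotuM ?dotu_deltar ?mxE ?eqxx //; apply: unitary_adj.
have [un4 s4 _] := uM4.
pose g4 := adjm M4 *m g3.
have ug4 : unitary g4 by apply: unitaryM => //; apply: unitary_adj.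
have s4S : supp S M4 by apply: sub_supp s4 => i /andP[].
have sg4 : supp S g4 by apply: suppM => //; apply: supp_adj.
have row0g4 : row a0 g4 = delta_mx 0 a0.
  rewrite row_mul (supp_row (supp_adj s4)) -?rowE //.
  by rewrite negb_and negbK Ia orbT.
exists (adjm (adjm M1) *m M4), g4, (adjm H), t; split=> //.
- apply: supp_blockM; first (apply: supp_block_adj; apply: supp_block_adj).
    by apply: sub_supp_block uM1; [move=> i /andP[]|move=> i j /andP[_ ->] /andP[_ ->]].
  by apply: sub_supp_block uM4;
    [move=> i /andP[]|move=> i j /andP[_ /negPf ->] /andP[_ /negPf ->]].
- exact: supp_block_adj.
(* The support is reduced twice: by row [a0], then by column [b0] read as a row of the adjoint. *)
- have := supp_reduce ug4 sg4 row0g4 => /supp_adj /(supp_reduce (unitary_adj ug4)) sg4'.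
  rewrite -(adjmK g4); apply: supp_adj; apply: (sub_supp _ (sg4' b0 _)).
    by move=> i /andP[/andP[-> ->] ->].
  by rewrite adjmM adjmK row_mul hM4.
- have -> : adjm (adjm M1) *m M4 *m g4 = adjm (adjm M1) *m g3.
    by rewrite /g4 mulmxA -(mulmxA _ M4) unitary_adjr // mulmx1.
  rewrite -(mulmxA _ g3) -(mulmxA g2) unitary_adjl // mulmx1 -mulmxA.
  rewrite -(mulmxA g1) unitary_adjr // mulmx1 /g1 mulmxA adjmK.
  by rewrite unitary_adjr // mul1mx.
Qed.

(** The set [T] is kept abstract because the induction lowers [r] while all the rotations must end
    in the torus of the initial [r] planes. *)
Lemma cs_decomposition r (S I J : pred 'I_n) (a b : 'I_r -> 'I_n)
    (T : set 'M[R]_n) (g : 'M[C]_n) :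
    T 1%:M -> (forall A B, T A -> T B -> T (A *m B)) ->
    (forall k t, T (plane_rot (a k) (b k) t)) ->
    injective a -> injective b ->
    (forall k, [/\ S (a k) & J (a k)]) ->
    (forall k, [/\ S (b k), ~~ I (b k) & ~~ J (b k)]) ->
    (forall i, S i -> I i = [exists k, i == a k]) ->
    unitary g -> supp S g ->
  exists x B h, [/\ supp_block I S x, T B, supp_block J S h & g = x *m cplx_mx B *m h].
Proof.
move=> T1 TM; elim: r S a b g => [|r IH] S a b g Trot injA injB Sa Sb SI ug sg.
  exists g, 1%:M, 1%:M; split=> //; last by rewrite cplx_mx1 !mulmx1.
    split=> // i j; have [/andP[Si Sj]|nS] := boolP (S i && S j); last first.
      by rewrite sg //; case: eqVneq => [->|].
    have no_pair (k : 'I_n) : [exists l : 'I_0, k == a l] = false.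
      by apply/existsP => -[[]].
    by rewrite !SI // !no_pair.
  exact: supp_block1.
have [X [G [H [t [uX uH uG sG ->]]]]] := cs_step injA injB Sa Sb SI ug sg.
have a_b k l : a k != b l.
  by have [_ Ja] := Sa k; have [_ _ nJ] := Sb l; apply: contraNneq nJ => <-.
have [|||k|k|i|x [B [h [ux TB uh ->]]]] := IH _ (a \o lift ord0) (b \o lift ord0) G _ _ _ _ _ _ uG sG.
- by move=> k t'; apply: Trot.
- exact: inj_comp injA lift_inj.
- exact: inj_comp injB lift_inj.
- have [-> ->] := Sa (lift ord0 k); split=> //=.
  by rewrite (inj_eq injA) eq_sym neq_lift a_b.
- have [-> -> ->] := Sb (lift ord0 k); split=> //=.
  by rewrite (inj_eq injB) [_ == a _]eq_sym a_b eq_sym neq_lift.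
- move=> /and3P[Si ia ib]; rewrite SI //; apply/existsP/existsP => -[k /eqP e].
    have [l e'|e'] := unliftP ord0 k; first by exists l; rewrite e e'.
    by move: ia; rewrite e e' eqxx.
  by exists (lift ord0 k); rewrite e.
exists (X *m x), (B *m plane_rot (a ord0) (b ord0) t), (h *m H); split.
- by apply: supp_blockM => //; apply: sub_supp_block ux => [i /and3P[]|].
- exact: TM.
- by apply: supp_blockM => //; apply: sub_supp_block uh => [i /and3P[]|].
- have [_ sh _] := uh.
  rewrite cplx_mxM !mulmxA -(mulmxA _ h) -(mulmxA _ (rot _ _ t) h); congr (_ *m _).
  rewrite -!mulmxA; congr (_ *m (_ *m (_ *m _))).
  apply: supp_comm sh (supp_plane_rot t) => i /and3P[_ ia ib].
  by rewrite /= negb_or ia ib.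
Qed.

End GeneralizedCS.

(** * Blocks of sizes 1, n2, n3: alternating rows and columns *)

Section Herringbone.
Variables (R : realType) (n n2 n3 p q : nat).
Hypotheses (n_L : (1 + n2 + n3)%N = n) (n_H : (p + q)%N = n).
Local Notation C := R[i].
Local Notation rot a b t := (cplx_mx (plane_rot a b t)).

Let fL (i : 'I_n) : nat := if i == 0%N :> nat then 0%N else if (i <= n2)%N then 1%N else 2%N.
Let fH (i : 'I_n) : nat := (i < p)%N.

Variables T1 T2 : set 'M[R]_n.
Hypotheses (T1_1 : T1 1%:M) (T2_1 : T2 1%:M)
  (T1M : forall A B, T1 A -> T1 B -> T1 (A *m B))
  (T2M : forall A B, T2 A -> T2 B -> T2 (A *m B))
  (T1rot : forall (i j : 'I_n) t, (i + j)%N = n ->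
     (0 < i <= minn (minn p q) (minn n2 n3))%N -> T1 (plane_rot i j t))
  (T2rot : forall (i j : 'I_n) t, (i + j).+1 = n ->
     (i < minn (minn p q) (minn n2.+1 n3.+1))%N -> T2 (plane_rot i j t)).

(* Row [k] is cleared by a rotation in the plane [(k, n-1-k)] and an element of
   [H], then column [n-1-k] by a rotation in the plane [(k+1, n-1-k)] and an
   element of [L]. Every block factor used later fixes the coordinates of the
   planes used before, so that the rotations can be collected. *)
Lemma herringbone e k (g : 'M[C]_n) :
    (n <= e + k)%N -> (k <= minn n2 n3)%N -> unitary g ->
    supp (fun i : 'I_n => k <= i < n - k)%N g ->
  exists x B1 B2 h,
    [/\ supp_block fL (fun i : 'I_n => k < i < n - k)%N x, T1 B1, T2 B2,
        supp_block fH (fun i : 'I_n => k <= i < n - k)%N h &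
        g = x *m cplx_mx B1 *m cplx_mx B2 *m h].
Proof.
elim: e k g => [|e IH] k g ek kmin ug sg; first by exfalso; lia.
(* The window from [k] to [n - k] now lies on one side of [p], so [g] itself belongs to [H]. *)
have [pqk|] := leqP (minn p q) k.
  exists 1%:M, 1%:M, 1%:M, g; split=> //; first exact: supp_block1.
    split=> // i j; have [/andP[Si Sj]|nS] := boolP ((k <= i < n - k) && (k <= j < n - k))%N.
      by rewrite /fH; lia.
    by rewrite sg //; case: eqVneq => [->|].
  by rewrite cplx_mx1 !mul1mx.
rewrite leq_min => /andP[kp kq].
have ltk : (k < n)%N by lia.
have ltk' : (n - k.+1 < n)%N by lia.
have [||||M [N [t [gE uM sM uN]]]] := @clear_row R n fH
  (fun i : 'I_n => k <= i < n - k)%N g (Ordinal ltk) (Ordinal ltk') ug sg.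
- by rewrite /=; lia.
- by rewrite /=; lia.
- by rewrite /fH /=; lia.
- by move=> j _; rewrite /fH /=; lia.
have {}sM : supp (fun i : 'I_n => k < i < n - k)%N M.
  apply: (sub_supp _ sM) => i /andP[ki ik].
  have : (i : nat) != k by apply: contra ik => /eqP h; apply/eqP/val_inj.
  by lia.
have T2t : T2 (plane_rot (Ordinal ltk) (Ordinal ltk') t).
  by apply: T2rot; rewrite /=; lia.
(* Here [k = minn n2 n3], and the window without its left end lies in a single block, so [M] belongs
   to [L]. This row rotation has no column rotation after it, which explains the bounds [n2.+1] and
   [n3.+1] for the second torus. *)
have [k23|] := leqP (minn n2 n3) k.
  exists M, 1%:M, (plane_rot (Ordinal ltk) (Ordinal ltk') t), N; split=> //.
    split=> // i j; have [/andP[Si Sj]|nS] := boolP ((k < i < n - k) && (k < j < n - k))%N.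
      by rewrite /fL; repeat case: ifP; lia.
    by rewrite sM //; case: eqVneq => [->|].
  by rewrite cplx_mx1 mulmx1.
rewrite leq_min => /andP[k2 k3].
have ltk1 : (k.+1 < n)%N by lia.
have [||||M' [N' [t' [ME uM' sM' uN']]]] := @clear_col R n fL
  (fun i : 'I_n => k < i < n - k)%N M (Ordinal ltk') (Ordinal ltk1) uM sM.
- by rewrite /=; lia.
- by rewrite /=; lia.
- by rewrite /fL /=; repeat case: ifP; lia.
- by move=> j; rewrite /fL /=; repeat case: ifP; lia.
have {}sM' : supp (fun i : 'I_n => k.+1 <= i < n - k.+1)%N M'.
  apply: (sub_supp _ sM') => i /andP[ki ik].
  have : (i : nat) != (n - k.+1)%N by apply: contra ik => /eqP h; apply/eqP/val_inj.
  by lia.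
have [||x [B1 [B2 [h [ux TB1 TB2 uh M'E]]]]] := IH k.+1 M' _ _ uM' sM'.
- by lia.
- by lia.
exists (N' *m x), (plane_rot (Ordinal ltk1) (Ordinal ltk') t' *m B1),
  (B2 *m plane_rot (Ordinal ltk) (Ordinal ltk') t), (h *m N); split.
- by apply: supp_blockM => //; apply: sub_supp_block ux => [i|//]; lia.
- by apply: T1M => //; apply: T1rot; rewrite /=; lia.
- exact: T2M.
- by apply: supp_blockM => //; apply: sub_supp_block uh => [i|//]; lia.
have [_ sx _] := ux; have [_ sh _] := uh.
have cx : rot (Ordinal ltk1) (Ordinal ltk') t' *m x = x *m rot (Ordinal ltk1) (Ordinal ltk') t'.
  symmetry; apply: supp_comm sx (supp_plane_rot _) => i /= ki.
  by rewrite -!val_eqE /=; lia.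
have ch : h *m rot (Ordinal ltk) (Ordinal ltk') t = rot (Ordinal ltk) (Ordinal ltk') t *m h.
  apply: supp_comm sh (supp_plane_rot _) => i /= ki.
  by rewrite -!val_eqE /=; lia.
rewrite gE ME M'E !cplx_mxM !mulmxA -(mulmxA _ h) ch !mulmxA.
by rewrite -(mulmxA _ _ x) cx !mulmxA.
Qed.

End Herringbone.

(** * One distinguished column *)

Section SinglePivot.
Variables (R : realType) (n : nat).
Local Notation C := R[i].
Local Notation rot a b t := (cplx_mx (plane_rot a b t)).

Lemma exists_clearing_angle (c d : R) :
  exists t, cos (t * (pi *+ 2)) * d + sin (t * (pi *+ 2)) * c = 0.
Proof.
have [e|cd] := eqVneq (c ^+ 2 + d ^+ 2) 0.
  exists 0; rewrite mul0r cos0 sin0 mul0r addr0 mul1r.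
  by apply/eqP; rewrite -sqrf_eq0; apply/eqP; nra.
have cd0 : 0 <= c ^+ 2 + d ^+ 2 by rewrite addr_ge0 ?sqr_ge0.
set m := Num.sqrt (c ^+ 2 + d ^+ 2).
have m0 : m != 0 by rewrite sqrtr_eq0 -ltNge lt_def cd.
(* The unit vector chosen is orthogonal to [(d, c)]. *)
have [|t [ct st]] := @exists_angle R (c / m) (- d / m).
  by rewrite !expr_div_n sqrrN -mulrDl sqr_sqrtr // mulfV.
by exists t; rewrite ct st !mulNr; field.
Qed.

Variables (f : 'I_n -> nat) (i0 : 'I_n) (s : nat -> 'I_n).

(** A real rotation can cancel the entry of block [j] against the pivot entry only if both are real.
    The first is made real by a unitary of block [j]; the second stays real through the induction,
    which is the role of [c]. *)
Lemma pivot_decomposition (js : seq nat) (c : R) (g : 'M[C]_n) :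
    uniq js -> f i0 \notin js -> (forall j, j \in js -> f (s j) = j) ->
    unitary g -> g i0 i0 = (c%:C)%C ->
    (forall i, i != i0 -> f i \notin js -> g i i0 = 0) ->
  exists x B h, [/\ supp_block f (fun i => f i \in js) x,
    prodset [seq rot_torus (fun _ : 'I_1 => i0) (fun=> s j) | j <- js] B,
    supp_block (fun i => i == i0) predT h & g = x *m cplx_mx B *m h].
Proof.
elim: js c g => [|j js IH] c g.
  move=> _ _ _ ug gc gi0; exists 1%:M, 1%:M, g; split=> //; first exact: supp_block1.
    split=> // i j; have [->|ii0] := eqVneq i i0; last first.
      by have [-> _|//] := eqVneq j i0; apply: gi0.
    have [//|ji0 _] := eqVneq j i0.
    (* With column [i0] zero off the pivot, orthogonality of columns forces row [i0] to be zero off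
       the pivot as well. *)
    have gram l : (g i0 i0)^* * g i0 l = (i0 == l)%:R.
      have /matrixP/(_ i0 l) := unitary_adjl ug; rewrite !mxE => <-.
      rewrite (bigD1 i0) //= big1 ?addr0 ?adjmE // => k ki0.
      by rewrite adjmE gi0 // conjC0 mul0r.
    have := gram j; rewrite eq_sym (negPf ji0) => /eqP.
    rewrite mulf_eq0 => /orP[/eqP g0|/eqP //].
    by have := gram i0; rewrite g0 mul0r eqxx => /eqP; rewrite eq_sym oner_eq0.
  by rewrite cplx_mx1 !mul1mx.
move=> /= /andP[jjs ujs]; rewrite inE negb_or => /andP[fi0j fi0js] fs ug gc gi0.
have fsj : f (s j) = j by apply: fs; rewrite mem_head.
have i0s : i0 != s j by apply: contraNneq fi0j => ->; rewrite fsj.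
have [||i //|M [d [uM d0 Moff Mon]]] := @unitary_block_to_delta R n
  (row i0 (adjm g)) predT (fun i => f i == j) (s j) => //.
  by rewrite fsj.
have [unM sM _] := uM.
have [t ht] := exists_clearing_angle c d.
pose g1 := adjm M *m g.
have g1E i : g1 i i0 = ((row i0 (adjm g) *m M) 0 i)^*.
  have -> : row i0 (adjm g) *m M = row i0 (adjm g1) by rewrite -row_mul /g1 adjmM adjmK.
  by rewrite [row _ _ 0 i]mxE adjmE conjCK.
have g1off i : f i != j -> g1 i i0 = g i i0.
  by move=> h; rewrite g1E Moff // mxE adjmE conjCK.
have g1on i : f i = j -> g1 i i0 = (d%:C)%C * (i == s j)%:R.
  by move=> h; rewrite g1E Mon ?h // rmorphM /= conj_real rmorph_nat.
have uR : unitary (rot i0 (s j) t) by apply/unitary_cplx_mx/orthogonal_plane_rot.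
pose g2 := adjm (rot i0 (s j) t) *m g1.
have ug2 : unitary g2.
  by apply: unitaryM; [exact: unitary_adj|apply: unitaryM => //; exact: unitary_adj].
have adjR : adjm (rot i0 (s j) t) = rot i0 (s j) (- t).
  by rewrite adjm_cplx_mx tr_plane_rot.
have rowcplx (A : 'M[R]_n) i (x y : R) k l : row i A = x *: delta_mx 0 k + y *: delta_mx 0 l ->
    row i (cplx_mx A) = (x%:C)%C *: delta_mx 0 k + (y%:C)%C *: delta_mx 0 l.
  move=> /rowP h; apply/rowP => m; have := h m; rewrite !mxE => ->.
  by rewrite rmorphD !rmorphM !rmorph_nat.
have g1i0 : g1 i0 i0 = (c%:C)%C by rewrite g1off.
have g1s : g1 (s j) i0 = (d%:C)%C by rewrite g1on // eqxx mulr1.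
have g2off i : i != i0 -> i != s j -> g2 i i0 = g1 i i0.
  move=> ii0 isj; rewrite /g2 adjR (supp_mulEl _ _ (supp_plane_rot _)) //=.
  by rewrite negb_or ii0.
have entry_row i : g2 i i0 = (row i (rot i0 (s j) (- t)) *m g1) 0 i0.
  by rewrite /g2 adjR -row_mul [RHS]mxE.
have rowsum (x y : R) k l : ((x%:C)%C *: delta_mx 0 k + (y%:C)%C *: delta_mx 0 l : 'rV[C]_n) *m g1
    = (x%:C)%C *: row k g1 + (y%:C)%C *: row l g1.
  by rewrite mulmxDl -!scalemxAl -!rowE.
have g2i0 : g2 i0 i0 = ((cos (- t * (pi *+ 2)) * c + sin (- t * (pi *+ 2)) * d)%:C)%C.
  have := row_plane_rot i0 (- t) i0s; rewrite eqxx => /rowcplx rE.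
  rewrite entry_row rE rowsum [LHS]mxE [X in X + _]mxE [X in _ + X]mxE.
  by rewrite [row i0 g1 _ _]mxE [row (s j) g1 _ _]mxE g1i0 g1s rmorphD !rmorphM.
have g2s : g2 (s j) i0 = 0.
  have := row_plane_rot (s j) (- t) i0s; rewrite eqxx eq_sym (negPf i0s).
  rewrite -scaleNr => /rowcplx rE.
  rewrite entry_row rE rowsum [LHS]mxE [X in X + _]mxE [X in _ + X]mxE.
  rewrite [row i0 g1 _ _]mxE [row (s j) g1 _ _]mxE g1i0 g1s -!rmorphM -rmorphD /=.
  by rewrite mulNr cosN sinN opprK ht.
have [|//|k kjs|//|i ii0 fi|x [B [h [ux pB uh g2E]]]] := IH _ g2 _ _ _ _ g2i0.
- exact: ujs.
- by apply: fs; rewrite inE kjs orbT.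
- have [->|isj] := eqVneq i (s j); first exact: g2s.
  rewrite g2off //; have [fij|fij] := eqVneq (f i) j.
    by rewrite g1on // (negPf isj) mulr0.
  by rewrite g1off // gi0 // inE negb_or fij.
exists (M *m x), (plane_rot i0 (s j) t *m B), h; split=> //.
- apply: supp_blockM.
    apply: sub_supp_block uM => [i /andP[_ /eqP ->]|]; first exact: mem_head.
    by move=> i k /andP[_ /eqP ->] /andP[_ /eqP ->].
  by apply: sub_supp_block ux => [i h'|//]; rewrite inE h' orbT.
- by exists (plane_rot i0 (s j) t), B; split=> //; exists (const_mx t).
have [_ sx _] := ux.
(* The factor [x] lives in the blocks of [js], which contain neither [i0] nor [s j]. *)
have cx : rot i0 (s j) t *m x = x *m rot i0 (s j) t.
  symmetry; apply: supp_comm sx (supp_plane_rot _) => i fi /=; rewrite negb_or.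
  apply/andP; split; apply: contraTneq fi => -> //.
  by rewrite fsj.
transitivity (M *m (rot i0 (s j) t *m g2)).
  rewrite /g2 [rot _ _ _ *m _]mulmxA unitary_adjr // mul1mx /g1 mulmxA.
  by rewrite unitary_adjr // mul1mx.
by rewrite g2E cplx_mxM !mulmxA -(mulmxA M) cx !mulmxA.
Qed.

(** A unitary in the block of [i0] itself supplies the real pivot entry and clears the rest of that
    block. *)
Lemma single_pivot_decomposition (js : seq nat) (g : 'M[C]_n) :
    uniq js -> f i0 \notin js -> (forall j, j \in js -> f (s j) = j) ->
    (forall i, f i \in f i0 :: js) -> unitary g ->
  exists x B h, [/\ supp_block f predT x,
    prodset [seq rot_torus (fun _ : 'I_1 => i0) (fun=> s j) | j <- js] B,
    supp_block (fun i => i == i0) predT h & g = x *m cplx_mx B *m h].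
Proof.
move=> ujs fi0 fs fall ug.
have [||i //|M [d [uM d0 Moff Mon]]] := @unitary_block_to_delta R n
  (row i0 (adjm g)) predT (fun i => f i == f i0) i0 => //.
have [unM _ _] := uM.
pose g1 := adjm M *m g.
have ug1 : unitary g1 by apply: unitaryM => //; apply: unitary_adj.
have g1E i : g1 i i0 = ((row i0 (adjm g) *m M) 0 i)^*.
  have -> : row i0 (adjm g) *m M = row i0 (adjm g1) by rewrite -row_mul /g1 adjmM adjmK.
  by rewrite [row _ _ 0 i]mxE adjmE conjCK.
have g1on i : f i = f i0 -> g1 i i0 = (d%:C)%C * (i == i0)%:R.
  by move=> h; rewrite g1E Mon ?h // rmorphM /= conj_real rmorph_nat.
have [|i ii0 fi|x [B [h [ux pB uh g1xBh]]]] :=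
  pivot_decomposition (c := d) ujs fi0 fs ug1.
- by rewrite g1on // eqxx mulr1.
- have := fall i; rewrite inE (negPf fi) orbF => /eqP h.
  by rewrite g1on // (negPf ii0) mulr0.
exists (M *m x), B, h; split=> //.
- apply: supp_blockM; last by apply: sub_supp_block ux.
  apply: sub_supp_block uM => [//|].
  by move=> i k /andP[_ /eqP ->] /andP[_ /eqP ->].
by rewrite -!(mulmxA M) -g1xBh /g1 mulmxA unitary_adjr // mul1mx.
Qed.

End SinglePivot.

(** * Three blocks against a block of size two *)

Section ThreeBlocks.
Variables (R : realType) (n : nat).
Local Notation C := R[i].
Local Notation rot a b t := (cplx_mx (plane_rot a b t)).
Local Notation im a := (fun i : 'I_n => [exists k, i == a k]).
Implicit Types (g D : 'M[C]_n).

Lemma cs_decomposition_torus r (S I J : pred 'I_n) (a b : 'I_r -> 'I_n) g :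
    injective a -> injective b ->
    (forall k, [/\ S (a k) & J (a k)]) ->
    (forall k, [/\ S (b k), ~~ I (b k) & ~~ J (b k)]) ->
    (forall i, S i -> I i = [exists k, i == a k]) ->
    unitary g -> supp S g ->
  exists x B h, [/\ supp_block I S x, rot_torus a b B, supp_block J S h &
                    g = x *m cplx_mx B *m h].
Proof.
move=> injA injB Sa Sb SI ug sg.
have a_b k l : a k != b l.
  by have [_ Ja] := Sa k; have [_ _ nJ] := Sb l; apply: contraNneq nJ => <-.
apply: cs_decomposition Sa Sb SI ug sg => //.
- exact: rot_torus1.
- by move=> A B; apply: rot_torusM.
- by move=> k t; apply: rot_torus_plane_rot.
Qed.

(** Passing to the adjoint exchanges the two groups, so the block enumerated by [a] may belong to
    [H] instead of [L]. *)
Lemma cs_decomposition_torus_adj r (S I J : pred 'I_n) (a b : 'I_r -> 'I_n) g :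
    injective a -> injective b ->
    (forall k, [/\ S (a k) & I (a k)]) ->
    (forall k, [/\ S (b k), ~~ I (b k) & ~~ J (b k)]) ->
    (forall i, S i -> J i = [exists k, i == a k]) ->
    unitary g -> supp S g ->
  exists x B h, [/\ supp_block I S x, rot_torus a b B, supp_block J S h &
                    g = x *m cplx_mx B *m h].
Proof.
move=> injA injB Sa Sb SJ ug sg.
have a_b k l : a k != b l.
  by have [_ Ia] := Sa k; have [_ nI _] := Sb l; apply: contraNneq nI => <-.
have [|x [B [h [ux TB uh e]]]] := cs_decomposition_torus injA injB Sa _ SJ
  (unitary_adj ug) (supp_adj sg).
  by move=> k; have [-> -> ->] := Sb k.
exists (adjm h), B^T, (adjm x); split; try exact: supp_block_adj.
- exact: rot_torusT.
- by rewrite -(adjmK g) e !adjmM adjm_cplx_mx mulmxA.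
Qed.

Local Notation diagonal := (@nat_of_ord n).

Lemma diagonal_mulE S D (A : 'M[C]_n) i j : supp_block diagonal S D ->
  (D *m A) i j = D i i * A i j.
Proof.
move=> [_ _ dD]; rewrite mxE (bigD1 i) //= big1 ?addr0 // => k ki.
by rewrite dD ?mul0r // => /val_inj e; rewrite e eqxx in ki.
Qed.

Lemma mul_diagonalE S D (A : 'M[C]_n) i j : supp_block diagonal S D ->
  (A *m D) i j = A i j * D j j.
Proof.
move=> [_ _ dD]; rewrite mxE (bigD1 j) //= big1 ?addr0 // => k kj.
by rewrite dD ?mulr0 // => /val_inj e; rewrite e eqxx in kj.
Qed.

(* Copying the phases of [D] to the partner coordinates makes [D] commute with
   the torus. *)
Lemma phase_transfer r (a b : 'I_r -> 'I_n) (S : pred 'I_n) D :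
    injective a -> injective b -> (forall k l, a k != b l) ->
    supp_block diagonal S D ->
  exists2 D', supp_block diagonal (fun i => S (swap_planes a b i)) D' &
    forall B : 'M[R]_n, rot_torus a b B ->
      (D *m D') *m cplx_mx B = cplx_mx B *m (D *m D').
Proof.
move=> injA injB a_b uD; have [unD sD dD] := uD.
pose sw := swap_planes a b; have swK := swap_planesK R injA injB a_b.
pose D' : 'M[C]_n := \matrix_(i, j) (D (sw i) (sw i) * (i == j)%:R).
have normD i : D i i * (D i i)^* = 1.
  have /matrixP/(_ i i) := unD; rewrite -/(adjm _) (diagonal_mulE _ _ _ uD) adjmE => ->.
  by rewrite mxE eqxx.
have uD' : supp_block diagonal (fun i => S (sw i)) D'.
  split.
  - apply/matrixP => i j; rewrite -/(adjm _) mxE (bigD1 i) //= adjmE !mxE eqxx mulr1.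
    rewrite big1 ?addr0 => [|k ki]; last by rewrite !mxE eq_sym (negPf ki) mulr0 mul0r.
    rewrite rmorphM rmorph_nat /= [j == i]eq_sym.
    by have [->|] := eqVneq i j; rewrite ?mulr1 ?mulr0 // normD.
  - move=> i j h; rewrite mxE; have [e|_] := eqVneq i j; last by rewrite mulr0.
    by rewrite mulr1 sD ?eqxx //; move: h; rewrite -e andbb => /negPf ->.
  - move=> i j h; rewrite mxE; case: eqVneq => [e|_]; last by rewrite mulr0.
    by rewrite e in h.
exists D' => // B [x _ <-]; apply/matrixP => i j.
rewrite -mulmxA (diagonal_mulE _ _ _ uD) (diagonal_mulE _ _ _ uD').
rewrite mulmxA (mul_diagonalE _ _ _ uD') (mul_diagonalE _ _ _ uD) ![D' _ _]mxE !eqxx !mulr1.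
rewrite ![cplx_mx _ _ _]mxE ![rotmx _ _ _ _ _]mxE.
have [->|ij] := eqVneq i j; first by ring.
have [e|_] := eqVneq (swap_planes a b i) j; last by rewrite !mulr0 addr0 rmorph0 !(mulr0, mul0r).
rewrite /sw -e swK; ring.
Qed.

(** The image of [a] is the block of size two of [H]. Between the torus [B1] of the planes (b, c)
    and the torus [B3] of the planes (a, b) stands a unitary on the two coordinates of [b]. Its left
    diagonal part crosses [B1] and its right one crosses [B3]; the corrections live on [c] and on
    [a] respectively, and leave through [H] and through [L]. *)
Lemma three_block_decomposition (f : 'I_n -> nat) (la lb lc : nat)
    (a b c : 'I_2 -> 'I_n) g :
    la != lb -> la != lc -> lb != lc -> injective a -> injective b -> injective c ->
    (forall k, f (a k) = la) -> (forall k, f (b k) = lb) -> (forall k, f (c k) = lc) ->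
    (forall i, [|| f i == la, f i == lb | f i == lc]) -> unitary g ->
  exists x B1 B2 B3 h, [/\ supp_block f predT x,
    [/\ rot_torus b c B1, rot_torus (fun _ : 'I_1 => b ord0) (fun=> b ord_max) B2 &
        rot_torus a b B3],
    supp_block (im a) predT h &
    g = x *m cplx_mx B1 *m cplx_mx B2 *m cplx_mx B3 *m h].
Proof.
move=> lab lac lbc injA injB injC fa fb fc fall ug.
have neqf i j : f i != f j -> i != j by apply: contraNneq => ->.
have a_b k l : a k != b l by apply: neqf; rewrite fa fb.
have b_c k l : b k != c l by apply: neqf; rewrite fb fc.
have a_c k l : a k != c l by apply: neqf; rewrite fa fc.
have ima i : im a i -> f i = la by move=> /existsP[k /eqP ->].
have imb i : im b i -> f i = lb by move=> /existsP[k /eqP ->].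
have imc i : im c i -> f i = lc by move=> /existsP[k /eqP ->].
have in_im (d : 'I_2 -> 'I_n) k : im d (d k) by apply/existsP; exists k.
have nim (d : 'I_2 -> 'I_n) l i : (forall i, im d i -> f i = l) -> f i != l -> ~~ im d i.
  by move=> h; apply: contra => /h ->.
pose PA : pred 'I_n := fun i => f i == la.
have [||i||x [B3 [h [ux TB3 uh ->]]]] := @cs_decomposition_torus_adj 2 predT PA (im a)
    a b g injA injB _ _ _ ug.
- by move=> k; rewrite /PA fa.
- by move=> k; rewrite /PA fb eq_sym lab (nim a la) // fb eq_sym.
- by [].
- by [].
have xPA i j : PA i != PA j -> x i j = 0.
  by have [_ _ dx] := ux; move=> hij; apply: dx; move: hij; case: (PA i); case: (PA j).
have [xA [x' [-> uxA ux']]] : exists xA x',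
    [/\ x = xA *m x', supp_block PA PA xA & supp_block PA (predC PA) x'].
  exists (restr PA x), (restr (predC PA) x); split; first exact: restr_split.
    by apply: sub_supp_block (supp_block_restr ux xPA) => // i /andP[].
  apply: sub_supp_block (supp_block_restr ux _) => // i j hij.
  by apply: xPA; move: hij => /=; case: (PA i); case: (PA j).
have [unx' sx' _] := ux'.
(* Inside the union of the blocks [lb] and [lc], the image of [b] now plays the part that the image
   of [a] had. *)
have [||i|y [B1 [k [uy TB1 uk ->]]]] := @cs_decomposition_torus_adj 2 (predC PA)
    (fun i => f i == lb) (im b) b c x' injB injC _ _ _ unx' sx'.
- by move=> k; rewrite /= /PA fb eqxx eq_sym.
- by move=> k; rewrite /= /PA fc ![lc == _]eq_sym lac lbc (nim b lb) // fc eq_sym.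
- by [].
have kQ i j : im b i != im b j -> k i j = 0.
  by have [_ _ dk] := uk; move=> hij; apply: dk; move: hij; case: [exists _, i == _]; case: [exists _, j == _].
(* The factor [k1] avoids both [a] and [b], hence passes [B3] and joins [H]; only [k2], in U(2), is
   trapped. *)
have [k2 [k1 [-> uk2 uk1]]] : exists k2 k1, [/\ k = k2 *m k1,
    supp_block (im b) (im b) k2 & supp_block (im b) (fun i => ~~ PA i && ~~ im b i) k1].
  exists (restr (im b) k), (restr (predC (im b)) k); split; first exact: restr_split.
    by apply: sub_supp_block (supp_block_restr uk kQ) => // i /andP[].
  apply: supp_block_restr uk _ => i j hij.
  by apply: kQ; move: hij => /=; case: [exists _, i == _]; case: [exists _, j == _].
have b0b1 : b ord0 != b ord_max by rewrite (inj_eq injB).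
have imbE i : im b i -> i = b ord0 \/ i = b ord_max.
  move=> /existsP[l /eqP ->]; have [l' ->|->] := unliftP ord0 l; last by left.
  by right; congr b; rewrite (ord1 l'); apply: val_inj.
have [unk2 sk2 _] := uk2.
(* With every coordinate its own block, [N] is diagonal; [M] is diagonal too, as its support is a
   single coordinate. *)
have [||||M [N [t [-> uM sM uN]]]] := @clear_row R n diagonal (im b) k2
  (b ord0) (b ord_max) unk2 sk2.
- exact: in_im.
- exact: in_im.
- by move=> /val_inj e; rewrite e eqxx in b0b1.
- by move=> j /imbE[] ->; [left|right].
have {uM sM} uM : supp_block diagonal (im b) M.
  split=> //; first by apply: sub_supp sM => i /andP[].
  move=> i j ij; rewrite sM.
    by case: eqVneq => // e; rewrite e in ij.
  apply/negP => /andP[/andP[/imbE hi ib] /andP[/imbE hj jb]]; apply: ij.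
  by case: hi hj ib jb => -> [] ->; rewrite ?eqxx.
have [DM uDM cDM] := phase_transfer injB injC b_c uM.
have [DN uDN cDN] := phase_transfer injA injB a_b uN.
have {}uDM : supp_block diagonal (im c) DM.
  apply: sub_supp_block uDM => // i; have [l ->|l -> _|nb nc] := planeP b c i.
  - by rewrite swap_planes_a // => /imb /eqP; rewrite fc eq_sym (negPf lbc).
  - exact: in_im.
  - have [-> _] := off_planes R nb nc.
    by move=> /existsP[l e]; have := nb l; rewrite e.
have {}uDN : supp_block diagonal (im a) DN.
  apply: sub_supp_block uDN => // i; have [l -> _|l ->|na nb] := planeP a b i.
  - exact: in_im.
  - by rewrite swap_planes_b // => /imb /eqP; rewrite fa (negPf lab).
  - have [-> _] := off_planes R na nb.
    by move=> /existsP[l e]; have := nb l; rewrite e.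
have [unDM sDM _] := uDM; have [unDN sDN _] := uDN.
have [_ sM _] := uM; have [_ sN _] := uN; have [_ sy _] := uy; have [_ sk1 _] := uk1.
have sB1 := supp_cplx_rot_torus TB1; have sB3 := supp_cplx_rot_torus TB3.
have sr : supp (im b) (rot (b ord0) (b ord_max) t).
  by apply: (sub_supp _ (supp_plane_rot t)) => i /orP[] /eqP ->; apply: in_im.
have saDM := supp_adj sDM; have saDN := supp_adj sDN.
have pass (X Y : 'M[C]_n) (S P : pred 'I_n) : supp S X -> supp P Y ->
    (forall i, S i -> ~~ P i) -> forall Z : 'M[C]_n, X *m (Y *m Z) = Y *m (X *m Z).
  by move=> sX sY dSP Z; rewrite mulmxA (supp_comm dSP sX sY) mulmxA.
have la_lb := negPf lab; have la_lc := negPf lac; have lb_lc := negPf lbc.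
have dis (d d' : 'I_2 -> 'I_n) l l' : (forall i, im d i -> f i = l) ->
    (forall i, im d' i -> f i = l') -> l != l' -> forall i, im d i -> ~~ im d' i.
  move=> hd hd' ll' i /hd fi; apply/negP => /hd' fi'.
  by rewrite -fi fi' eqxx in ll'.
have dis2 (d d' d'' : 'I_2 -> 'I_n) : (forall i, im d i -> ~~ im d' i) ->
    (forall i, im d i -> ~~ im d'' i) ->
    forall i, im d i -> ~~ [exists k, (i == d' k) || (i == d'' k)].
  move=> h1 h2 i hi; apply/existsPn => m; rewrite negb_or.
  by have /existsPn -> := h1 i hi; have /existsPn -> := h2 i hi.
have nba : lb != la by rewrite eq_sym.
have nca : lc != la by rewrite eq_sym.
have ncb : lc != lb by rewrite eq_sym.
have cN : N *m DN = DN *m N.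
  by apply: supp_comm sN sDN; apply: dis imb ima nba.
have c1 : forall Z : 'M[C]_n, k1 *m (cplx_mx B3 *m Z) = cplx_mx B3 *m (k1 *m Z).
  apply: pass sk1 sB3 _ => i /andP[nPA nb]; apply/existsPn => l; rewrite negb_or.
  apply/andP; split; last by have /existsPn := nb; apply.
  by apply: contra nPA => /eqP ->; rewrite /PA fa.
(* The product [N *m DN] commutes with [B3]; the price is [adjm DN], supported on [a], which travels
   left into [L]. *)
have c2 (Z : 'M[C]_n) : N *m (cplx_mx B3 *m Z) = adjm DN *m (cplx_mx B3 *m (N *m (DN *m Z))).
  transitivity (adjm DN *m (DN *m N *m cplx_mx B3) *m Z).
    by rewrite !mulmxA unitary_adjl // mul1mx.
  by rewrite -cN cDN // !mulmxA.
have c3 (Z : 'M[C]_n) : cplx_mx B1 *m (M *m Z) = M *m (DM *m (cplx_mx B1 *m (adjm DM *m Z))).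
  transitivity (M *m DM *m cplx_mx B1 *m (adjm DM *m Z)); last by rewrite !mulmxA.
  by rewrite cDM // -!mulmxA [DM *m (_ *m _)]mulmxA unitary_adjr // mul1mx.
have c4 := pass _ _ _ _ saDM sr (dis _ _ _ _ imc imb ncb).
have c6 := pass _ _ _ _ saDM saDN (dis _ _ _ _ imc ima nca).
have c7 := pass _ _ _ _ saDM sB3
  (dis2 _ _ _ (dis _ _ _ _ imc ima nca) (dis _ _ _ _ imc imb ncb)).
have c5 := pass _ _ _ _ sr saDN (dis _ _ _ _ imb ima nba).
have c8 Z := esym (pass _ _ _ _ saDN sB1
  (dis2 _ _ _ (dis _ _ _ _ ima imb lab) (dis _ _ _ _ ima imc lac)) Z).
have c9 := pass _ _ _ _ sDM saDN (dis _ _ _ _ imc ima nca).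
have c10 := pass _ _ _ _ sM saDN (dis _ _ _ _ imb ima nba).
have c11 : forall Z : 'M[C]_n, y *m (adjm DN *m Z) = adjm DN *m (y *m Z).
  by apply: pass sy saDN _ => i; rewrite /= /PA => hi; apply: nim hi.
have diag_f S (D : 'M[C]_n) (e : 'I_n -> nat) : supp_block diagonal S D -> supp_block e predT D.
  by move=> uD; apply: sub_supp_block uD => // i j _ _ /val_inj ->.
exists (xA *m (adjm DN *m (y *m (M *m DM)))), B1, (plane_rot (b ord0) (b ord_max) t), B3,
  (adjm DM *m (N *m DN *m (k1 *m h))); split.
- apply: supp_blockM; first apply: sub_supp_block uxA => // i j.
    by rewrite /PA => /eqP -> /eqP ->.
  apply: supp_blockM; first exact/supp_block_adj/diag_f/uDN.
  apply: supp_blockM; last by apply: supp_blockM; apply: diag_f; [exact: uM|exact: uDM].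
  apply: sub_supp_block uy => // i j; rewrite /= /PA => ia ja.
  have := fall i; have := fall j; rewrite (negPf ia) (negPf ja) /=.
  have [->|] := eqVneq (f i) lb; have [->|] := eqVneq (f j) lb => //=.
  by move=> _ _ /eqP -> /eqP ->.
- by split=> //; exists (const_mx t).
- apply: supp_blockM; first exact/supp_block_adj/diag_f/uDM.
  apply: supp_blockM.
    by apply: supp_blockM; apply: diag_f; [exact: uN|exact: uDN].
  apply: supp_blockM => //; apply: sub_supp_block uk1 => // i j.
  rewrite /PA => /andP[ia _] /andP[ja _] _.
  by rewrite (negPf (nim a la i ima ia)) (negPf (nim a la j ima ja)).
rewrite -!mulmxA; move: c1 c2 c3 c4 c5 c6 c7 c8 c9 c10 c11.
(* With an opaque product, failing matches do not unfold [mulmx]. *)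
move: (adjm DM) (adjm DN) (cplx_mx B1) (cplx_mx B3) (rot _ _ t) => X Y Z1 Z3 Z2.
move: (@mulmx _ n n n) => mul c1 c2 c3 c4 c5 c6 c7 c8 c9 c10 c11.
by rewrite c1 c2 c3 c4 c6 c7 c5 c8 c9 c10 c11.
Qed.

End ThreeBlocks.

(** * Block indices of a composition *)

Lemma psums_cons m ns : psums (m :: ns) = m :: [seq (m + s)%N | s <- psums ns].
Proof.
rewrite /psums /= big_ord_recl big_ord0 /= addr0; congr cons.
rewrite -[1%N]addn0 iotaDl -!map_comp; apply: eq_map => k /=.
by rewrite big_ord_recl.
Qed.

Lemma blk_cons m ns i : blk (m :: ns) i = if (i < m)%N then 0%N else (blk ns (i - m)).+1.
Proof.
rewrite /blk psums_cons /=; case: ltnP => // mi; congr S.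
by rewrite find_map; apply: eq_find => s /=; rewrite ltn_subLR.
Qed.

Lemma ltn_blk ns i : (i < sumn ns)%N -> (blk ns i < size ns)%N.
Proof.
elim: ns i => [//|m ns IH] i /= hi; rewrite blk_cons; case: (ltnP i m) => // mi.
by rewrite ltnS IH // ltn_subLR.
Qed.

Lemma blk_surj ns j : all (fun m => 0 < m)%N ns -> (j < size ns)%N ->
  exists2 i, (i < sumn ns)%N & blk ns i = j.
Proof.
elim: ns j => [//|m ns IH] [|j] /= /andP[m0 pos] hj.
  by exists 0%N; rewrite ?blk_cons ?m0 // addn_gt0 m0.
have [i hi ij] := IH j pos hj; exists (m + i)%N; first by rewrite ltn_add2l.
by rewrite blk_cons ltnNge leq_addr /= addKn ij.
Qed.

(** * The four cases *)

Section Decompositions.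
Variables (R : realType) (n : nat).
Local Notation C := R[i].

Lemma Lsub_supp_block ns (f : 'I_n -> nat) (x : 'M[C]_n) :
    (forall i j : 'I_n, f i = f j -> blk ns i = blk ns j) ->
  supp_block f predT x -> Lsub ns x.
Proof. by move=> fb [ux _ dx]; split=> // i j h; apply: dx => /fb. Qed.

Lemma blk2 p q (i : 'I_n) : (p + q)%N = n -> blk [:: p; q] i = ~~ (i < p)%N.
Proof.
move=> pq; have := ltn_ord i; rewrite !blk_cons; case: (ltnP i p) => //= pi hi.
by have -> : (i - p < q)%N by lia.
Qed.

Lemma blk3 n1 n2 n3 (i : 'I_n) : (n1 + n2 + n3)%N = n ->
  blk [:: n1; n2; n3] i = if (i < n1)%N then 0%N else if (i < n1 + n2)%N then 1%N else 2%N.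
Proof.
move=> n123; have := ltn_ord i; rewrite !blk_cons; case: (ltnP i n1) => //= h1 hi.
have -> : (i - n1 < n2)%N = (i < n1 + n2)%N by lia.
case: (ltnP i (n1 + n2)) => // h2.
by have -> : (i - n1 - n2 < n3)%N by lia.
Qed.

Lemma has_decomp_prodset ns p q dims (Ts : seq (set 'M[R]_n)) :
    size Ts = size dims ->
    (forall j, (j < size Ts)%N -> toral (nth 0%N dims j) (nth set0 Ts j)) ->
    LBH_decomp ns p q (prodset Ts) ->
  has_decomp R n ns p q dims.
Proof. by move=> sz tor dec; exists (prodset Ts); split=> //; exists Ts. Qed.

Lemma prodset1 (T : set 'M[R]_n) B : T B -> prodset [:: T] B.
Proof. by move=> TB; exists B, 1%:M; rewrite mulmx1. Qed.

Lemma prodset_cons (T : set 'M[R]_n) Ts B B' :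
  T B -> prodset Ts B' -> prodset (T :: Ts) (B *m B').
Proof. by move=> TB TB'; exists B, B'. Qed.

Definition ord_fun r (F : nat -> nat) (hF : forall k, (k < r)%N -> (F k < n)%N)
  (k : 'I_r) : 'I_n := Ordinal (hF k (ltn_ord k)).

(** A common form for the four possible positions of the smallest block: [I] and [J] select one
    block on each side, [F] enumerates the smaller of the two, and [G] gives partner coordinates
    outside both. *)
Lemma two_blocks (r n1 n2 p q : nat) (I J : pred 'I_n) (F G : nat -> nat) :
    (n1 + n2)%N = n -> (p + q)%N = n ->
    (forall i j, I i = I j -> (i < n1)%N = (j < n1)%N) ->
    (forall i j, J i = J j -> (i < p)%N = (j < p)%N) ->
    (forall k, (k < r)%N -> (F k < n)%N /\ (G k < n)%N) ->
    (forall k l, (k < r)%N -> (l < r)%N -> F k = F l -> k = l) ->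
    (forall k l, (k < r)%N -> (l < r)%N -> G k = G l -> k = l) ->
    (forall (i : 'I_n) k, (k < r)%N -> i = F k :> nat -> I i /\ J i) ->
    (forall (i : 'I_n) k, (k < r)%N -> i = G k :> nat -> ~~ I i /\ ~~ J i) ->
    (forall i : 'I_n, I i -> exists2 k, (k < r)%N & i = F k :> nat) \/
    (forall i : 'I_n, J i -> exists2 k, (k < r)%N & i = F k :> nat) ->
  has_decomp R n [:: n1; n2] p q [:: r].
Proof.
move=> n12 pq hI hJ ltFG injF injG FIJ GIJ IJ.
pose a := ord_fun (fun k hk => proj1 (ltFG k hk)).
pose b := ord_fun (fun k hk => proj2 (ltFG k hk)).
have injA : injective a by move=> k l [/(injF _ _ (ltn_ord k) (ltn_ord l)) /val_inj].
have injB : injective b by move=> k l [/(injG _ _ (ltn_ord k) (ltn_ord l)) /val_inj].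
have aI k : I (a k) by have [] := FIJ (a k) k (ltn_ord k) erefl.
have aJ k : J (a k) by have [] := FIJ (a k) k (ltn_ord k) erefl.
have bI k : ~~ I (b k) by have [] := GIJ (b k) k (ltn_ord k) erefl.
have bJ k : ~~ J (b k) by have [] := GIJ (b k) k (ltn_ord k) erefl.
have a_b k l : a k != b l by apply: contraNneq (bI l) => <-.
have cover (P : pred 'I_n) : (forall k, P (a k)) ->
    (forall i : 'I_n, P i -> exists2 k, (k < r)%N & i = F k :> nat) ->
    forall i, P i = [exists k, i == a k].
  move=> Pa hP i; apply/idP/existsP => [/hP[k kr e]|[k /eqP -> //]].
  by exists (Ordinal kr); apply/eqP/val_inj.
apply: (@has_decomp_prodset _ _ _ _ [:: rot_torus a b]) => //.
  by case=> // _; apply: toral_rot_torus.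
move=> g ug; have sg : supp predT g by [].
have [x [B [h [ux TB uh ->]]]] : exists x B h, [/\ supp_block I predT x,
    rot_torus a b B, supp_block J predT h & g = x *m cplx_mx B *m h].
  case: IJ => /cover hP.
    by apply: cs_decomposition_torus ug sg => // i _; apply: hP.
  by apply: cs_decomposition_torus_adj ug sg => // i _; apply: hP.
have inj_bool (P Q : bool) : (P : nat) = Q -> P = Q by case: P; case: Q.
exists x, B, h; split=> //; last 1 first.
- apply: Lsub_supp_block uh => i j /inj_bool /hJ e.
  by rewrite !blk2 // e.
- apply: Lsub_supp_block ux => i j /inj_bool /hI e.
  by rewrite !blk2 // e.
- exact: prodset1.
Qed.

Lemma case_two_blocks n1 n2 p q : (n1 + n2)%N = n -> (p + q)%N = n ->
  has_decomp R n [:: n1; n2] p q [:: minn (minn n1 n2) (minn p q)].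
Proof.
move=> n12 pq.
have [h1|h1] := leqP n1 (minn n2 (minn p q)).
  have -> : minn (minn n1 n2) (minn p q) = n1 by lia.
  apply: (@two_blocks _ _ _ _ _ (fun i => i < n1)%N (fun i => i < p)%N
    id (addn p)) => //; try by move=> *; lia.
  by left=> i hi; exists i.
have [h2|h2] := leqP n2 (minn n1 (minn p q)).
  have -> : minn (minn n1 n2) (minn p q) = n2 by lia.
  apply: (@two_blocks _ _ _ _ _ (fun i => ~~ (i < n1)%N) (fun i => ~~ (i < p)%N)
    (addn n1) id) => //; try by move=> *; lia.
  by left=> i hi; exists (i - n1)%N; have := ltn_ord i; lia.
have [h3|h3] := leqP p (minn q (minn n1 n2)).
  have -> : minn (minn n1 n2) (minn p q) = p by lia.
  apply: (@two_blocks _ _ _ _ _ (fun i => i < n1)%N (fun i => i < p)%N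
    id (addn n1)) => //; try by move=> *; lia.
  by right=> i hi; exists i.
have -> : minn (minn n1 n2) (minn p q) = q by lia.
apply: (@two_blocks _ _ _ _ _ (fun i => ~~ (i < n1)%N) (fun i => ~~ (i < p)%N)
  (addn p) id) => //; try by move=> *; lia.
by right=> i hi; exists (i - p)%N; have := ltn_ord i; lia.
Qed.

Lemma case_one_and_two_blocks n2 n3 p q : (1 + n2 + n3)%N = n -> (p + q)%N = n ->
  has_decomp R n [:: 1%N; n2; n3] p q
    [:: minn (minn p q) (minn n2 n3); minn (minn p q) (minn n2.+1 n3.+1)].
Proof.
move=> n23 pq; set m := minn _ (minn n2 n3); set m' := minn _ (minn n2.+1 _).
have lt1 k : (k < m)%N -> (k.+1 < n)%N by lia.
have lt2 k : (k < m)%N -> (n - k.+1 < n)%N by lia.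
have lt3 k : (k < m')%N -> (k < n)%N by lia.
have lt4 k : (k < m')%N -> (n - k.+1 < n)%N by lia.
(* Column planes have coordinate sum [n], row planes have sum [n - 1]; hence the shift by one
   between [a1] and [a2]. *)
pose a1 := ord_fun lt1; pose b1 := ord_fun lt2.
pose a2 := ord_fun lt3; pose b2 := ord_fun lt4.
have injA1 : injective a1 by move=> k l [/val_inj].
have injB1 : injective b1.
  by move=> k l [e]; apply: val_inj => /=; have := ltn_ord k; have := ltn_ord l; lia.
have injA2 : injective a2 by move=> k l [/val_inj].
have injB2 : injective b2.
  by move=> k l [e]; apply: val_inj => /=; have := ltn_ord k; have := ltn_ord l; lia.
have ab1 k l : a1 k != b1 l.
  by rewrite -val_eqE /=; have := ltn_ord k; have := ltn_ord l; lia.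
have ab2 k l : a2 k != b2 l.
  by rewrite -val_eqE /=; have := ltn_ord k; have := ltn_ord l; lia.
apply: (@has_decomp_prodset _ _ _ _ [:: rot_torus a1 b1; rot_torus a2 b2]) => //.
  by move=> [|[|//]] _; apply: toral_rot_torus.
move=> g ug.
have T1rot (i j : 'I_n) (t : R) : (i + j)%N = n -> (0 < i <= m)%N ->
    rot_torus a1 b1 (plane_rot i j t).
  move=> ij hi; have hk : (i.-1 < m)%N by lia.
  have -> : i = a1 (Ordinal hk) by apply: val_inj => /=; lia.
  have -> : j = b1 (Ordinal hk) by apply: val_inj => /=; lia.
  exact: rot_torus_plane_rot.
have T2rot (i j : 'I_n) (t : R) : (i + j).+1 = n -> (i < m')%N ->
    rot_torus a2 b2 (plane_rot i j t).
  move=> ij hi.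
  have -> : i = a2 (Ordinal hi) by apply: val_inj.
  have -> : j = b2 (Ordinal hi) by apply: val_inj => /=; lia.
  exact: rot_torus_plane_rot.
have [||||x [B1 [B2 [h [ux TB1 TB2 uh ->]]]]] := herringbone n23 pq
    (rot_torus1 R a1 b1) (rot_torus1 R a2 b2)
    (fun A B => @rot_torusM R n m a1 b1 injA1 injB1 ab1 A B)
    (fun A B => @rot_torusM R n m' a2 b2 injA2 injB2 ab2 A B) T1rot T2rot
    (e := n) (k := 0%N) (g := g).
- by rewrite addn0.
- by [].
- exact: ug.
- by move=> i j; rewrite subn0 !ltn_ord.
exists x, (B1 *m B2), h; split.
- have {}ux := sub_supp_block (P := predT) (fun _ _ => isT) (fun _ _ _ _ e => e) ux.
  apply: Lsub_supp_block ux => i j e.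
  by rewrite !blk3 //; move: e; do ! case: ifP; lia.
- by apply: prodset_cons => //; apply: prodset1.
- have {}uh := sub_supp_block (P := predT) (fun _ _ => isT) (fun _ _ _ _ e => e) uh.
  apply: Lsub_supp_block uh => i j e.
  by rewrite !blk2 //; move: e; lia.
- by rewrite cplx_mxM !mulmxA.
Qed.

Lemma three_blocks n1 n2 n3 p q (la lb lc : nat) (a b c : 'I_2 -> 'I_n) :
    (n1 + n2 + n3)%N = n -> (p + q)%N = n ->
    la != lb -> la != lc -> lb != lc -> injective a -> injective b -> injective c ->
    (forall k, blk [:: n1; n2; n3] (a k) = la) ->
    (forall k, blk [:: n1; n2; n3] (b k) = lb) ->
    (forall k, blk [:: n1; n2; n3] (c k) = lc) ->
    (forall i : 'I_n, let l := blk [:: n1; n2; n3] i in [|| l == la, l == lb | l == lc]) ->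
    (forall i j : 'I_n, [exists k, i == a k] = [exists k, j == a k] ->
      (i < p)%N = (j < p)%N) ->
  has_decomp R n [:: n1; n2; n3] p q [:: 2%N; 1%N; 2%N].
Proof.
move=> n123 pq lab lac lbc injA injB injC fa fb fc fall hp.
have neqf i j : blk [:: n1; n2; n3] (i : 'I_n) != blk [:: n1; n2; n3] (j : 'I_n) -> i != j.
  by apply: contraNneq => ->.
have a_b k l : a k != b l by apply: neqf; rewrite fa fb.
have b_c k l : b k != c l by apply: neqf; rewrite fb fc.
apply: (@has_decomp_prodset _ _ _ _ [:: rot_torus b c;
  rot_torus (fun _ : 'I_1 => b ord0) (fun=> b ord_max); rot_torus a b]) => //.
  move=> [|[|[|//]]] _; apply: toral_rot_torus => //.
  - by move=> k l _; rewrite !ord1.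
  - by move=> k l _; rewrite !ord1.
  - by move=> _ _; rewrite (inj_eq injB).
move=> g ug.
have [x [B1 [B2 [B3 [h [ux [TB1 TB2 TB3] uh ->]]]]]] :=
  three_block_decomposition lab lac lbc injA injB injC fa fb fc fall ug.
exists x, (B1 *m (B2 *m B3)), h; split.
- exact: Lsub_supp_block ux.
- by do 2! apply: prodset_cons => //; apply: prodset1.
- apply: Lsub_supp_block uh => i j e; rewrite !blk2 // (hp i j) //.
  by move: e; do 2! case: [exists _, _].
- by rewrite !cplx_mxM !mulmxA.
Qed.

Lemma case_three_blocks n1 n2 n3 p q : (n1 + n2 + n3)%N = n -> (p + q)%N = n ->
    (2 <= minn n1 (minn n2 n3))%N -> minn p q = 2%N ->
  has_decomp R n [:: n1; n2; n3] p q [:: 2%N; 1%N; 2%N].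
Proof.
move=> n123 pq hmin hpq.
have lt1 k : (k < 2)%N -> (k < n)%N by lia.
have lt2 k : (k < 2)%N -> (n1 + k < n)%N by lia.
have lt3 k : (k < 2)%N -> (n1 + n2 + k < n)%N by lia.
have lt4 k : (k < 2)%N -> (p + k < n)%N by lia.
have inj1 : injective (ord_fun lt1) by move=> k l [/val_inj].
have inj2 : injective (ord_fun lt2) by move=> k l [/addnI/val_inj].
have inj3 : injective (ord_fun lt3) by move=> k l [/addnI/val_inj].
have inj4 : injective (ord_fun lt4) by move=> k l [/addnI/val_inj].
have blkall (i : 'I_n) : (blk [:: n1; n2; n3] i <= 2)%N.
  by rewrite blk3 //; do ! case: ifP.
have blk1 k : blk [:: n1; n2; n3] (ord_fun lt1 k) = 0%N.
  by rewrite blk3 //=; have := ltn_ord k; do ! case: ifP; lia.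
have blk2' k : blk [:: n1; n2; n3] (ord_fun lt2 k) = 1%N.
  by rewrite blk3 //=; have := ltn_ord k; do ! case: ifP; lia.
have ex_ord (F : nat -> nat) (lt : forall k, (k < 2)%N -> (F k < n)%N) (i : 'I_n) :
    [exists k, i == ord_fun lt k] = (i == F 0%N :> nat) || (i == F 1%N :> nat).
  apply/existsP/orP => [[[[|[|//]] hk] /eqP ->]|[] /eqP e]; rewrite ?eqxx; [by left|by right| |].
    by exists ord0; apply/eqP/val_inj.
  by exists ord_max; apply/eqP/val_inj.
have [p2|q2] : p = 2%N \/ q = 2%N by lia.
  apply: (@three_blocks _ _ _ _ _ 0 1 2 (ord_fun lt1) (ord_fun lt2) (ord_fun lt3)) => //.
  - by move=> k; rewrite blk3 //=; have := ltn_ord k; do ! case: ifP; lia.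
  - by move=> i /=; have := blkall i; case: (blk _ i) => [|[|[|]]].
  - by move=> i j; rewrite !ex_ord p2; lia.
(* If [q = 2], the small block of [H] consists of the last two coordinates, which lie in the third
   block since [n3] is at least 2; the outer blocks exchange roles. *)
apply: (@three_blocks _ _ _ _ _ 2 1 0 (ord_fun lt4) (ord_fun lt2) (ord_fun lt1)) => //.
- by move=> k; rewrite blk3 //=; have := ltn_ord k; do ! case: ifP; lia.
- by move=> i /=; have := blkall i; case: (blk _ i) => [|[|[|]]].
- by move=> i j; rewrite !ex_ord; have := ltn_ord i; have := ltn_ord j; lia.
Qed.

Lemma case_single_pivot ns p q : all (fun m => 0 < m)%N ns -> (2 <= size ns)%N ->
    sumn ns = n -> (p + q)%N = n -> minn p q = 1%N ->
  has_decomp R n ns p q (nseq (size ns).-1 1%N).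
Proof.
move=> pos sz sn pq hpq.
(* The pivot is the coordinate of the block of size one of [H]: the first if [p = 1], the last if
   [q = 1]. *)
have [i0 hi0] : exists i0 : 'I_n, forall i j : 'I_n,
    (i == i0) = (j == i0) -> (i < p)%N = (j < p)%N.
  have [p1|q1] : p = 1%N \/ q = 1%N by lia.
    have n0 : (0 < n)%N by lia.
    by exists (Ordinal n0) => i j; rewrite -!val_eqE /= p1; lia.
  have n0 : (p < n)%N by lia.
  exists (Ordinal n0) => i j; rewrite -!val_eqE /=.
  by have := ltn_ord i; have := ltn_ord j; lia.
pose f (i : 'I_n) := blk ns i.
have f_lt i : (f i < size ns)%N by rewrite ltn_blk // sn.
pose s j := odflt i0 [pick i | f i == j].
have fs j : (j < size ns)%N -> f (s j) = j.
  move=> hj; rewrite /s; case: pickP => [i /eqP //|none].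
  have [i hi ij] := blk_surj pos hj; rewrite sn in hi.
  by have := none (Ordinal hi); rewrite /f /= ij eqxx.
(* Every block but that of the pivot contributes one circle, which gives one factor less than there
   are blocks. *)
pose js := rem (f i0) (iota 0 (size ns)).
have ujs : uniq js by rewrite rem_uniq // iota_uniq.
have mem_js j : (j \in js) = (j != f i0) && (j < size ns)%N.
  by rewrite mem_rem_uniq ?iota_uniq // inE mem_iota add0n.
have size_js : size js = (size ns).-1.
  by rewrite size_rem ?size_iota // mem_iota add0n f_lt.
apply: (@has_decomp_prodset ns p q _
  [seq rot_torus (R := R) (fun _ : 'I_1 => i0) (fun=> s j) | j <- js]).
- by rewrite size_map size_nseq size_js.
- rewrite size_map size_js => j hj; rewrite nth_nseq hj (nth_map 0%N) ?size_js //.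
  have : nth 0%N js j \in js by rewrite mem_nth ?size_js.
  rewrite mem_js => /andP[jf jlt]; apply: toral_rot_torus.
  + by move=> k l _; rewrite !ord1.
  + by move=> k l _; rewrite !ord1.
  + by move=> _ _; apply: contraNneq jf => e; rewrite {1}e fs.
move=> g ug.
have [|||x [B [h [ux pB uh ->]]]] :=
  @single_pivot_decomposition R n f i0 s js g ujs _ _ _ ug.
- by rewrite mem_js eqxx.
- by move=> j; rewrite mem_js => /andP[_ /fs].
- by move=> i; rewrite inE mem_js f_lt andbT orbN.
exists x, B, h; split=> //.
- exact: Lsub_supp_block ux.
- apply: Lsub_supp_block uh => i j e; rewrite !blk2 // (hi0 i j) //.
  by move: e; do 2! case: (_ == i0).
Qed.

End Decompositions.

Theorem theoremB (R : realType) (n p q : nat) (ns : seq nat) :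
  (2 <= size ns)%N ->
  all (fun m => 0 < m)%N ns ->
  (0 < p)%N -> (0 < q)%N ->
  sumn ns = n -> (p + q)%N = n ->
  let k := size ns in
  let n1 := nth 0%N ns 0 in
  let n2 := nth 0%N ns 1 in
  let n3 := nth 0%N ns 2 in
  (* Case 0 *)
  (k = 2%N ->
     has_decomp R n ns p q [:: minn (minn n1 n2) (minn p q)]) /\
  (* Case I *)
  (k = 3%N -> n1 = 1%N ->
     has_decomp R n ns p q
       [:: minn (minn p q) (minn n2 n3);
           minn (minn p q) (minn n2.+1 n3.+1)]) /\
  (* Case II *)
  (k = 3%N -> (2 <= minn n1 (minn n2 n3))%N -> minn p q = 2%N ->
     has_decomp R n ns p q [:: 2%N; 1%N; 2%N]) /\
  (* Case III *)
  (minn p q = 1%N ->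
     has_decomp R n ns p q (nseq k.-1 1%N)).
Proof.
move=> sz pos p0 q0 sn pq k n1 n2 n3; rewrite {}/k {}/n1 {}/n2 {}/n3.
split; [|split; [|split]].
- move: ns sz pos sn => [//|m1 [//|m2 [|//]]] _ _ /=; rewrite addn0 => sn _.
  exact: case_two_blocks.
- move: ns sz pos sn => [//|m1 [//|m2 [//|m3 [|//]]]] _ _ /=; rewrite addn0 => sn _ m1E.
  by rewrite m1E; apply: case_one_and_two_blocks; lia.
- move: ns sz pos sn => [//|m1 [//|m2 [//|m3 [|//]]]] _ _ /=; rewrite addn0 => sn _.
  by apply: case_three_blocks; lia.
- exact: case_single_pivot.
Qed.
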